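(* Let $l\ge 1$, let $\{u_j\}_{j=0}^{2l-1}$ be a complete Chebyshev set on the finite closed interval $[a,b]$, let $w>0$ be an integrable weight function on $[a,b]$, and let $c_j=\int_a^b u_j(t)w(t)\,dt$ for $j=0,\dots,2l-1$. Then the following successive one-dimensional root-finding procedure is well defined and ends with the $l$-point generalized Gaussian quadrature rule for $u_0,\dots,u_{2l-1}$. (1) (Start.) The equation $\frac{u_1(\xi)}{u_0(\xi)}=\frac{c_1}{c_0}$ has a unique solution $\underline{\xi}_1\in(a,b)$. The function $u_1/u_0$ is strictly monotonic on $[a,b]$, and the one-point rule with node $\underline{\xi}_1$ and weight $c_0/u_0(\underline{\xi}_1)>0$ is exact for $u_0,u_1$. (2) For each $k=1,\dots,l-1$, suppose $a<t_1<\dots<t_k<b$ and $\lambda_1,\dots,\lambda_k>0$ are the nodes and weights of the rule exact for $u_0,\dots,u_{2k-1}$ obtained so far (for $k=1$ from (1), for $k\geq 2$ from (2b) with $k-1$ in place of $k$), and put $\underline{\xi}_k=t_1$. (2a) For each $\xi\in[a,\underline{\xi}_k)$ there is a unique rule with $k+1$ nodes $\xi=x_1(\xi)<x_2(\xi)<\dots<x_{k+1}(\xi)=b$ and positive weights $w_1(\xi),\dots,w_{k+1}(\xi)$ that is exact for $u_0,\dots,u_{2k-1}$. Set $x_i(\underline{\xi}_k)=t_i$ and $w_i(\underline{\xi}_k)=\lambda_i$ for $i\le k$, and $x_{k+1}(\underline{\xi}_k)=b$, $w_{k+1}(\underline{\xi}_k)=0$. Then all nodes and weights are continuous on $[a,\underline{\xi}_k]$,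 the nodes $x_1,\dots,x_k$ are strictly increasing functions of $\xi$, and the function $$F_k(\xi)=\sum_{i=1}^{k+1}w_i(\xi)\,u_{2k}(x_i(\xi))-c_{2k}$$ is strictly monotonic on $[a,\underline{\xi}_k]$ and has exactly one zero $\overline{\xi}_k$ there. This zero satisfies $a<\overline{\xi}_k<\underline{\xi}_k$. The rule at $\xi=\overline{\xi}_k$ has positive weights, has $b$ as its last node and all other nodes in $(a,b)$, and is exact for $u_0,\dots,u_{2k}$. (2b) For each $\xi\in[a,\overline{\xi}_k)$ there is a unique rule with $k+1$ nodes $\xi=y_1(\xi)<y_2(\xi)<\dots<y_{k+1}(\xi)<b$ and positive weights $v_1(\xi),\dots,v_{k+1}(\xi)$ that is exact for $u_0,\dots,u_{2k}$. Define the rule at $\xi=\overline{\xi}_k$ to be the final rule of (2a). Then all nodes and weights are continuous on $[a,\overline{\xi}_k]$, all nodes are strictly increasing functions of $\xi$, and the function $$G_k(\xi)=\sum_{i=1}^{k+1}v_i(\xi)\,u_{2k+1}(y_i(\xi))-c_{2k+1}$$ is strictly monotonic on $[a,\overline{\xi}_k]$ and has exactly one zero $\underline{\xi}_{k+1}$ there. This zero satisfies $a<\underline{\xi}_{k+1}<\overline{\xi}_k$. The rule at $\xi=\underline{\xi}_{k+1}$ has $k+1$ nodes in $(a,b)$ and positive weights, and is exact for $u_0,\dots,u_{2k+1}$. Consequently $a<\underline{\xi}_l<\overline{\xi}_{l-1}<\underline{\xi}_{l-1}<\dots<\overline{\xi}_1<\underline{\xi}_1<b$, and the final rule (the rule of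 (1) if $l=1$, the rule of (2b) with $k=l-1$ otherwise) has $l$ nodes in $(a,b)$ and positive weights, and is exact for $u_0,\dots,u_{2l-1}$.
   Context: A set $\{u_j\}_{j=0}^{n}$ of continuous real-valued functions on $[a,b]$ is a Chebyshev set on $[a,b]$ if the determinant $\det\big(u_i(t_j)\big)_{i,j=0}^{n}$ does not vanish whenever $a\le t_0<t_1<\dots<t_n\le b$. An ordered set $\{u_j\}_{j=0}^{n}$ is a complete Chebyshev set if $\{u_j\}_{j=0}^{k-1}$ is a Chebyshev set for each $k=1,\dots,n+1$, i.e. the first $k$ elements form a Chebyshev set for each $k$. A (quadrature) rule with nodes $x_1,\dots,x_p\in[a,b]$ and weights $w_1,\dots,w_p$ is exact for a function $u_j$ if $\sum_{i=1}^p w_i u_j(x_i)=c_j$, where $c_j=\int_a^b u_j(t)w(t)\,dt$. The generalized Gaussian quadrature rule with $l$ points is the rule with $l$ nodes in $(a,b)$ and positive weights that is exact for the $2l$ functions $u_0,\dots,u_{2l-1}$. ''Strictly monotonic'' means strictly increasing or strictly decreasing. *)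

(* Defs.v *)
From HB Require Import structures.
From mathcomp Require Import all_boot all_order all_algebra.
From mathcomp Require Import all_classical all_reals all_analysis.
Set Implicit Arguments.
Unset Strict Implicit.
Unset Printing Implicit Defensive.
Import Order.TTheory GRing.Theory Num.Theory.
Import numFieldNormedType.Exports.
Local Open Scope classical_set_scope.
Local Open Scope ring_scope.

(* The set consists of the first [n] functions u_0, ..., u_(n-1). *)
Definition chebyshev_set (R : realType) (a b : R) (n : nat)
    (u : nat -> R -> R) : Prop :=
  (forall j, (j < n)%N -> {within `[a, b], continuous (u j)}) /\
  (forall t : 'I_n -> R,
     (forall i, a <= t i <= b) ->
     (forall i j : 'I_n, (i < j)%N -> t i < t j) ->
     \det (\matrix_(i < n, j < n) u i (t j)) != 0).

Definition complete_chebyshev_set (R : realType) (a b : R) (n : nat)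
    (u : nat -> R -> R) : Prop :=
  forall k, (1 <= k <= n)%N -> chebyshev_set a b k u.

Definition moment (R : realType) (a b : R) (u : nat -> R -> R) (w : R -> R)
    (j : nat) : R :=
  \int[@lebesgue_measure R]_(t in `[a, b]) (u j t * w t).

Record rule (R : realType) (n : nat) := Rule {
  node : 'I_n -> R;
  weight : 'I_n -> R
}.

Definition quad (R : realType) (n : nat) (r : rule R n) (f : R -> R) : R :=
  \sum_(i < n) weight r i * f (node r i).

(* Exactness for the first [m] functions u_0, ..., u_(m-1). *)
Definition exact_for (R : realType) (u : nat -> R -> R) (c : nat -> R)
    (m n : nat) (r : rule R n) : Prop :=
  forall j, (j < m)%N -> quad r (u j) = c j.

Definition increasing_nodes (R : realType) (n : nat) (r : rule R n) : Prop :=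
  forall i j : 'I_n, (i < j)%N -> node r i < node r j.

Definition positive_weights (R : realType) (n : nat) (r : rule R n) : Prop :=
  forall i : 'I_n, 0 < weight r i.

(* The nodes are listed in increasing order, so that a rule is determined by
   its node-weight pairs and uniqueness can be stated as equality. *)
Definition gauss_rule (R : realType) (a b : R) (u : nat -> R -> R)
    (c : nat -> R) (l : nat) (r : rule R l) : Prop :=
  [/\ increasing_nodes r, (forall i, a < node r i < b),
      positive_weights r & exact_for u c (2 * l) r].

(* [r] with the additional last node [z], of weight 0. *)
Definition add_null_node (R : realType) (n : nat) (r : rule R n) (z : R) :
    rule R n.+1 :=
  Rule (fun i => oapp (node r) z (unlift ord_max i))
       (fun i => oapp (weight r) 0 (unlift ord_max i)).

Definition rule_a (R : realType) (b : R) (u : nat -> R -> R) (c : nat -> R)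
    (k : nat) (xi : R) (r : rule R k.+1) : Prop :=
  [/\ node r ord0 = xi, node r ord_max = b, increasing_nodes r,
      positive_weights r & exact_for u c (2 * k) r].

Definition rule_b (R : realType) (b : R) (u : nat -> R -> R) (c : nat -> R)
    (k : nat) (xi : R) (r : rule R k.+1) : Prop :=
  [/\ node r ord0 = xi, node r ord_max < b, increasing_nodes r,
      positive_weights r & exact_for u c (2 * k).+1 r].

Definition strictly_increasing_on (R : realType) (a b : R) (f : R -> R) : Prop :=
  {in `[a, b] &, {homo f : s t / s < t}}.

Definition strictly_monotonic_on (R : realType) (a b : R) (f : R -> R) : Prop :=
  strictly_increasing_on a b f \/ {in `[a, b] &, {homo f : s t /~ s < t}}.

Definition continuous_rules_on (R : realType) (n : nat) (a b : R)
    (r : R -> rule R n) : Prop :=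
  forall i : 'I_n,
    {within `[a, b], continuous (fun xi => node (r xi) i)} /\
    {within `[a, b], continuous (fun xi => weight (r xi) i)}.

(* Main.v *)
Require Import Defs.
From HB Require Import structures.
From mathcomp Require Import all_boot all_order all_algebra perm.
From mathcomp Require Import all_classical all_reals all_analysis.
From mathcomp Require Import ring lra zify.
Set Implicit Arguments.
Unset Strict Implicit.
Unset Printing Implicit Defensive.
Import Order.TTheory GRing.Theory Num.Theory.
Import numFieldNormedType.Exports.
Local Open Scope classical_set_scope.
Local Open Scope ring_scope.

(** A discrete signed measure annihilating [u_0 .. u_(m-1)] has at least [m]
    sign changes: by completeness, for any [s < m] points there is a
    combination of [u_0 .. u_s] vanishing exactly at these points and changing
    sign at each of them.  Applied to the difference of two exact rules, this
    gives uniqueness when the supports together have at most [m] points; when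
    they have [m + 1] points, the weights of the difference alternate, so that
    the nodes interlace and the sign of the residual in [u_m] is known.

    A rule with first node [xi] exists because, among the exact rules on
    [[xi, b]], one has maximal weight at [xi]: if its other nodes had index at
    least [m] (interior nodes counting twice), splitting some of them into
    close pairs would allow a larger weight.  Nodes and weights are continuous
    since limits of exact rules are exact and the limit rule is unique.  The
    residual has opposite signs at the two ends of the parameter interval, by
    comparison with one positive rule exact for all the functions and with more
    than [2 l] nodes; such a rule is obtained by discretizing the integral on
    disjoint subintervals, by projection onto the cone of positive rules. *)

(** * Collocation determinants *)

(** The functions are only continuous, so there is no Jacobian for an implicit function theorem and
    a double zero has no meaning. Close pairs of simple zeros replace double zeros, and compactness
    replaces differentiation. The signs of the determinants are not normalized either: every sign is
    stated relative to fixed reference determinants, which is why the residual is only known to be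
    monotonic in one direction or the other. All steps of the procedure are instances of one step
    with a flag [o]. Its rules have [k + 1] nodes; the first is prescribed, and so is the last when
    [o] is false. The free nodes and the weights then number [2 * k + o], which is also the number
    of equations. The weight function enters only through the positive rule [P] with more than
    [2 * l] nodes; the steps use nothing else about the moments. *)

Lemma continuous_prodr (R : realType) (T : topologicalType) (I : Type) (r : seq I)
  (F : I -> T -> R) : (forall i, continuous (F i)) ->
  continuous (fun t => \prod_(i <- r) F i t).
Proof.
move=> h; elim: r => [|i r IH].
  by under eq_fun do rewrite big_nil; exact: cst_continuous.
under eq_fun do rewrite big_cons.
by move=> t; apply: cvgM; [exact: h|exact: IH].
Qed.

Lemma continuous_sumr (R : realType) (T : topologicalType) (I : Type) (r : seq I)
  (F : I -> T -> R) : (forall i, continuous (F i)) ->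
  continuous (fun t => \sum_(i <- r) F i t).
Proof.
move=> h; elim: r => [|i r IH].
  by under eq_fun do rewrite big_nil; exact: cst_continuous.
under eq_fun do rewrite big_cons.
by move=> t; apply: cvgD; [exact: h|exact: IH].
Qed.

Section Collocation.
Variables (R : realType) (a b : R).
Implicit Types (u : nat -> R -> R) (s d : seq R).

(** The points form a list, so that inserting and deleting points are list operations; the dimension
    [p] is a separate argument, so that the list can be rewritten without changing the type of the
    matrix. *)
Definition evdet u p s : R := \det (\matrix_(i < p, j < p) u i (nth 0 s j)).

Definition ordered_in s := sorted <%R s && all [pred t | a <= t <= b] s.

Lemma ordered_inP s : ordered_in s ->
  [/\ sorted <%R s, uniq s & forall t, t \in s -> a <= t <= b].
Proof.
case/andP=> so /allP h; split=> [||t /h] //.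
exact: lt_sorted_uniq so.
Qed.

Lemma evdet_swap u p s1 s2 x y : p = size (s1 ++ [:: x, y & s2]) ->
  evdet u p (s1 ++ [:: x, y & s2]) = - evdet u p (s1 ++ [:: y, x & s2]).
Proof.
move=> hp; have lt1 : ((size s1).+1 < p)%N by rewrite hp size_cat /= !addnS ltnS leq_addr.
have lt0 := ltnW lt1.
pose i0 := Ordinal lt0; pose i1 := Ordinal lt1.
have ne : i0 != i1 by rewrite -val_eqE /= neq_ltn ltnSn.
have -> : evdet u p (s1 ++ [:: x, y & s2]) =
    \det (xcol i0 i1 (\matrix_(i < p, j < p) u i (nth 0 (s1 ++ [:: y, x & s2]) j))).
  congr (\det _); apply/matrixP=> i j; rewrite !mxE; congr (u _ _).
  case: tpermP => [->|->|/eqP n0 /eqP n1] /=.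
  - by rewrite !nth_cat ltnn subnn ltnNge leqnSn /= subSnn.
  - by rewrite !nth_cat ltnn subnn ltnNge leqnSn /= subSnn.
  have m0 : (j : nat) != size s1 by rewrite (_ : (j != size s1 :> nat) = (j != i0)).
  have m1 : (j : nat) != (size s1).+1 by rewrite (_ : (j != (size s1).+1 :> nat) = (j != i1)).
  rewrite !nth_cat; case: ltnP => // le.
  rewrite -(subnKC le) in m0 m1 *; rewrite addKn.
  case: (j - size s1)%N m0 m1 => [|[|k]] //.
  - by rewrite addn0 eqxx.
  - by rewrite addn1 eqxx.
by rewrite xcolE det_mulmx det_perm odd_tperm ne expr1 mulrN1.
Qed.

(** Each point of [d1] that [z] passes costs one swap of adjacent columns. *)
Lemma evdet_insert u p s d1 d2 z : p = size (s ++ z :: d1 ++ d2) ->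
  evdet u p (s ++ z :: d1 ++ d2) =
  (-1) ^+ size d1 * evdet u p (s ++ d1 ++ z :: d2).
Proof.
elim: d1 s => [|x d1 IH] s hp; first by rewrite mul1r.
rewrite evdet_swap //= exprS mulN1r mulNr; congr (- _).
have := IH (rcons s x); rewrite -!cats1 -!catA /= => -> //.
by rewrite hp !size_cat /= !addnS.
Qed.

Lemma evdet_mem u d z : z \in d -> evdet u (size d).+1 (z :: d) = 0.
Proof.
move=> zd; rewrite /evdet -det_tr.
have lt : ((index z d).+1 < (size d).+1)%N by rewrite ltnS index_mem.
apply: (@determinant_alternate _ _ _ ord0 (Ordinal lt)) => // j.
by rewrite !mxE /= nth_index.
Qed.

Lemma sorted_split d z : sorted <%R d -> z \notin d ->
  exists d1 d2, [/\ d = d1 ++ d2, sorted <%R (d1 ++ z :: d2) &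
    size d1 = count [pred x | x < z] d].
Proof.
elim: d => [|x d IH] //= so; first by exists [::], [::].
rewrite inE negb_or => /andP[zx zd].
have /= so' := path_sorted so.
have xd : forall y, y \in d -> x < y by apply/allP; exact: order_path_min lt_trans so.
case: (ltP x z) => [xz|].
  have [d1 [d2 [e1 e2 e3]]] := IH so' zd.
  exists (x :: d1), d2; rewrite e1 /= e3 e1 ?add1n; split=> //.
  rewrite path_min_sorted //; apply/allP => y.
  rewrite mem_cat inE => /or3P[h|/eqP->//|h]; apply: xd; rewrite e1 mem_cat h ?orbT //.
rewrite le_eqVlt (negPf zx) /= => zx'.
exists [::], (x :: d); split=> //=; first by rewrite zx'.
rewrite add0n; apply/esym/eqP; rewrite -[_ == _]negbK -lt0n -has_count.
apply/hasPn => y /xd /= h; rewrite -leNgt; exact/ltW/(lt_trans zx').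
Qed.

(** Laplace expansion in the column of [z]: as a function of [z] the determinant is the test
    combination vanishing on [d], and its leading coefficient is a smaller determinant, nonzero for
    a complete system. *)
Lemma evdet_expand u d : exists C : nat -> R,
  C (size d) = (-1) ^+ size d * evdet u (size d) d /\
  forall z, evdet u (size d).+1 (z :: d) = \sum_(i < (size d).+1) C i * u i z.
Proof.
pose A z := \matrix_(i < (size d).+1, j < (size d).+1) u i (nth 0 (z :: d) j).
(* These cofactors do not involve the first column, so the point 0 is arbitrary. *)
exists (fun i => cofactor (A 0) (inord i) ord0); split.
  rewrite /cofactor addn0 inordK //; congr (_ * \det _).
  apply/matrixP => i j; rewrite !mxE; congr (u _ _).
  rewrite /= /bump inordK // leqNgt ltn_ord add0n //.
move=> z; rewrite /evdet (expand_det_col _ ord0); apply: eq_bigr => i _.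
rewrite mxE /= mulrC inord_val; congr (_ * _).
rewrite /cofactor; congr (_ * \det _).
by apply/matrixP => i' j; rewrite !mxE.
Qed.

End Collocation.

(** * Signs of the determinants *)

Section Orientation.
Variables (R : realType) (a b : R) (n : nat) (u : nat -> R -> R).
Hypothesis hu : complete_chebyshev_set a b n u.
Hypothesis hab : a < b.

(** Composed with this retraction, a function continuous on [[a, b]] becomes continuous on the whole
    line. *)
Definition clamp (t : R) : R := Num.max a (Num.min b t).

Lemma clamp_in t : a <= clamp t <= b.
Proof. by rewrite /clamp le_max lexx /= ge_max ge_min lexx ltW. Qed.

Lemma clamp_id t : a <= t <= b -> clamp t = t.
Proof.
by case/andP=> h1 h2; rewrite /clamp (min_idPr h2) (max_idPr h1).
Qed.

Lemma continuous_clamp : continuous clamp.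
Proof.
move=> t; apply: continuous_max; first exact: cvg_cst.
by apply: continuous_min; [exact: cvg_cst|exact: cvg_id].
Qed.

Lemma cheb_continuous j : (j < n)%N -> continuous (u j \o clamp).
Proof.
move=> jn t; have [|/(_ _ jn) hc _] := hu (k := n).
  by rewrite leqnn andbT (leq_ltn_trans _ jn).
move/subspace_continuousP: hc => /(_ (clamp t)) hc.
apply: (@cvg_comp _ _ _ clamp (u j) _ (within `[a, b] (nbhs (clamp t)))); last first.
  by apply: hc; rewrite /= in_itv /= clamp_in.
move=> P; rewrite /within /= => /continuous_clamp.
by apply: (filterS (F := nbhs t)) => z; apply; rewrite /= in_itv /= clamp_in.
Qed.

Lemma evdet_neq0 s : ordered_in a b s -> (size s <= n)%N ->
  evdet u (size s) s != 0.
Proof.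
move=> /ordered_inP[so _ hs] sn; case: (posnP (size s)) => [-> | s0].
  by rewrite /evdet det_mx00 oner_neq0.
have [|_ h] := hu (k := size s); first by rewrite s0.
apply: (h (fun j => nth 0 s j)) => [i|i j ij].
  exact/hs/mem_nth.
by rewrite lt_sorted_ltn_nth ?inE.
Qed.

(** Convex combinations of two increasing lists are increasing, so the determinant does not vanish
    along the segment from [s] to [t], and by the intermediate value theorem it keeps its sign. *)
Lemma evdet_sign s t : ordered_in a b s -> ordered_in a b t ->
  size s = size t -> (size s <= n)%N ->
  0 < evdet u (size s) s * evdet u (size s) t.
Proof.
move=> gs gt est sn; have [so _ hs] := ordered_inP gs.
have [to _ ht] := ordered_inP gt.
set p := size s in est sn *.
pose x (l : R) j := (1 - l) * nth 0 s j + l * nth 0 t j.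
pose g l := \det (\matrix_(i < p, j < p) (u i \o clamp) (x l j)).
have gx (l : R) : 0 <= l <= 1 -> ordered_in a b (mkseq (x l) p).
  move=> /andP[l0 l1]; apply/andP; split.
    apply/(sortedP 0) => i; rewrite size_mkseq => ip.
    rewrite !nth_mkseq ?(ltnW ip) // /x.
    have h1 : nth 0 s i < nth 0 s i.+1 by rewrite lt_sorted_ltn_nth ?inE // -/p (ltnW ip).
    have h2 : nth 0 t i < nth 0 t i.+1.
      by rewrite lt_sorted_ltn_nth ?inE // -est // (ltnW ip).
    have h3 : 0 <= l * (nth 0 t i.+1 - nth 0 t i) by rewrite mulr_ge0 // subr_ge0 ltW.
    have h4 : 0 <= (1 - l) * (nth 0 s i.+1 - nth 0 s i) by rewrite mulr_ge0 ?subr_ge0 // ltW.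
    have [l2|l2] := ltP l 1; last by have -> : l = 1 by [lra]; lra.
    have : 0 < (1 - l) * (nth 0 s i.+1 - nth 0 s i) by rewrite mulr_gt0 ?subr_gt0.
    by lra.
  apply/allP => y /mapP[i]; rewrite mem_iota /= add0n => ip ->; rewrite /x.
  have /andP[h1 h2] := hs _ (mem_nth 0 ip).
  rewrite est in ip; have /andP[h3 h4] := ht _ (mem_nth 0 ip).
  by apply/andP; split; nra.
have gE (l : R) : 0 <= l <= 1 -> g l = evdet u p (mkseq (x l) p).
  move=> hl; congr (\det _); apply/matrixP => i j; rewrite !mxE /=.
  rewrite nth_mkseq // clamp_id //; case/ordered_inP: (gx _ hl) => _ _ h; apply: h.
  by apply/mapP; exists (j : nat); rewrite // mem_iota add0n ltn_ord.
have gn0 (l : R) : 0 <= l <= 1 -> g l != 0.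
  move=> hl; rewrite gE //; have := evdet_neq0 (gx _ hl).
  by rewrite size_mkseq; apply.
have g0 : g 0 = evdet u p s.
  rewrite gE ?lexx ?ler01 //; congr evdet; apply: (@eq_from_nth _ 0); first by rewrite size_mkseq.
  by move=> i; rewrite size_mkseq => ip; rewrite nth_mkseq // /x subr0 mul1r mul0r addr0.
have g1 : g 1 = evdet u p t.
  rewrite gE ?lexx ?ler01 //; congr evdet; apply: (@eq_from_nth _ 0); first by rewrite size_mkseq.
  by move=> i; rewrite size_mkseq => ip; rewrite nth_mkseq // /x subrr mul1r mul0r add0r.
have gc : continuous g.
  have -> : g = fun l => \sum_(s' : 'S_p) (-1) ^+ s' * \prod_(i < p) (u i \o clamp) (x l (s' i)).
    apply/funext => l; apply: eq_bigr => s' _; congr (_ * _).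
    by apply: eq_bigr => i _; rewrite mxE.
  apply: continuous_sumr => s' l.
  apply: cvgM; first exact: cvg_cst.
  have : continuous (fun l => \prod_(i < p) (u i \o clamp) (x l (s' i))); last exact.
  apply: continuous_prodr => i l'.
  apply: (@continuous_comp _ _ _ (fun l => x l (s' i)) (u i \o clamp)); last first.
    by apply: cheb_continuous; exact: leq_trans sn.
  rewrite /x; apply: cvgD; apply: cvgM; try exact: cvg_cst; last exact: cvg_id.
  by apply: cvgB; [exact: cvg_cst|exact: cvg_id].
rewrite -g0 -g1 ltNge; apply/negP => hle.
have [] := @IVT R g 0 1 0 ler01.
- by apply: continuous_subspaceT.
- by rewrite ge_min le_max; nra.
move=> c; rewrite in_itv /= => /gn0/eqP; by [].
Qed.

Definition equispaced p := mkseq (fun i => a + (b - a) * (i%:R / p%:R)) p.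

Lemma ordered_equispaced p : ordered_in a b (equispaced p).
Proof.
have ba : 0 < b - a by rewrite subr_gt0.
apply/andP; split.
  apply/(sortedP 0) => i; rewrite size_mkseq => ip.
  rewrite !nth_mkseq ?(ltnW ip) // ltrD2l ltr_pM2l // ltr_pM2r ?ltr_nat //.
  by rewrite invr_gt0 ltr0n (leq_trans _ ip).
apply/allP => y /mapP[i]; rewrite mem_iota /= add0n => ip ->.
have p0 : (0 : R) < p%:R by rewrite ltr0n (leq_ltn_trans _ ip).
have h0 : (0 : R) <= i%:R / p%:R by rewrite divr_ge0.
have h1 : (i%:R / p%:R : R) <= 1 by rewrite ler_pdivrMr // mul1r ler_nat ltnW.
by apply/andP; split; nra.
Qed.

(* Only the sign matters: it is that of [evdet] on any [p] increasing points. *)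
Definition orient p : R := evdet u p (equispaced p).

Lemma orient_evdet s : ordered_in a b s -> (size s <= n)%N ->
  0 < orient (size s) * evdet u (size s) s.
Proof.
move=> gs sn; rewrite mulrC; apply: evdet_sign => //; first exact: ordered_equispaced.
by rewrite size_mkseq.
Qed.

(** Moving [z] to its place in [d] passes exactly the points smaller than [z]. *)
Lemma evdet_cons_sign d z : ordered_in a b d -> a <= z <= b ->
  (size d < n)%N -> z \notin d ->
  0 < orient (size d).+1 * ((-1) ^+ count [pred x | x < z] d *
      evdet u (size d).+1 (z :: d)).
Proof.
move=> gd zab dn zd; have [so _ hd] := ordered_inP gd.
have [d1 [d2 [e1 e2 e3]]] := sorted_split so zd.
rewrite -e3; set p := (size d).+1.
have := @evdet_insert _ u p [::] d1 d2 z; rewrite /= -e1 => -> //.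
rewrite mulrA -expr2 sqrr_sign mul1r.
have gz : ordered_in a b (d1 ++ z :: d2).
  rewrite /ordered_in e2; apply/allP => y; rewrite mem_cat inE => h.
  case: (eqVneq y z) => [->//|yz]; apply: hd; rewrite e1 mem_cat.
  by move: h; rewrite inE (negPf yz).
have sz : size (d1 ++ z :: d2) = p by rewrite /p e1 !size_cat /= addnS.
by rewrite -sz; apply: orient_evdet => //; rewrite sz.
Qed.

(** It has the sign of the leading coefficient of a combination of [u_0 .. u_p] that has [p]
    prescribed zeros and is positive to the left of them. For monomials this sign is [(-1) ^+ p]. *)
Definition osign p : R := (-1) ^+ p * (orient p * orient p.+1).

(* A measure supported on [W] that annihilates [u_0 .. u_(s-1)], [s = size d],
   is tested against the combination of [u_0 .. u_s] that vanishes exactly on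
   [d] and changes sign there. *)
Lemma annihilator_sign (W d : seq R) (g : R -> R) (kap : R) :
  ordered_in a b d -> (size d < n)%N ->
  (forall z, z \in W -> a <= z <= b) ->
  (forall j, (j < size d)%N -> \sum_(z <- W) g z * u j z = 0) ->
  (forall z, z \in W -> z \notin d ->
     0 <= kap * g z * (-1) ^+ count [pred x | x < z] d) ->
  0 <= kap * osign (size d) * (\sum_(z <- W) g z * u (size d) z) /\
  ((exists z, [/\ z \in W, z \notin d & kap * g z != 0]) ->
   0 < kap * osign (size d) * (\sum_(z <- W) g z * u (size d) z)).
Proof.
move=> gd dn hW ann hs; set s := size d.
have [C [Cs Ce]] := evdet_expand u d.
(* Of the expansion in [u_0 .. u_s], annihilation leaves only the term of [u s]. *)
have sumE : \sum_(z <- W) g z * evdet u s.+1 (z :: d) =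
    (-1) ^+ s * evdet u s d * \sum_(z <- W) g z * u s z.
  transitivity (\sum_(i < s.+1) C i * \sum_(z <- W) g z * u i z).
    under eq_bigr do rewrite Ce mulr_sumr.
    rewrite exchange_big /=; apply: eq_bigr => i _; rewrite mulr_sumr.
    by apply: eq_bigr => z _; rewrite mulrCA.
  rewrite big_ord_recr /= big1 ?add0r ?Cs // => i _.
  by rewrite ann ?mulr0.
have ge z : z \in W -> 0 <= kap * orient s.+1 * (g z * evdet u s.+1 (z :: d)).
  move=> zW; have [zd|zd] := boolP (z \in d); first by rewrite evdet_mem // !mulr0.
  have h1 := hs _ zW zd; have h2 := evdet_cons_sign gd (hW _ zW) dn zd.
  have := mulr_ge0 h1 (ltW h2); set e := (-1) ^+ _.
  rewrite (_ : kap * g z * e * _ =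
    e ^+ 2 * (kap * orient s.+1 * (g z * evdet u s.+1 (z :: d)))); last by rewrite -/s; ring.
  by rewrite /e sqrr_sign mul1r.
have key : kap * orient s.+1 * (\sum_(z <- W) g z * evdet u s.+1 (z :: d)) * orient s ^+ 2 =
   (orient s * evdet u s d) * (kap * osign s * \sum_(z <- W) g z * u s z).
  by rewrite sumE /osign; ring.
have pos : 0 < orient s * evdet u s d by apply: orient_evdet => //; exact: ltnW.
have os : 0 < orient s ^+ 2.
  by rewrite exprn_even_gt0 //=; apply: contraTneq pos => ->; rewrite mul0r ltxx.
split=> [|[z [zW zd gz]]].
  rewrite -(pmulr_rge0 _ pos) -key pmulr_lge0 // mulr_sumr big_seq.
  by apply: sumr_ge0 => z zW; apply: ge.
rewrite -(pmulr_rgt0 _ pos) -key pmulr_lgt0 // mulr_sumr.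
have h0 : 0 < kap * orient s.+1 * (g z * evdet u s.+1 (z :: d)).
  rewrite lt_neqAle ge // andbT eq_sym.
  have := evdet_cons_sign gd (hW _ zW) dn zd; rewrite -/s.
  move/lt0r_neq0; rewrite !mulf_eq0 !negb_or => /and3P[h1 _ h2].
  by move: gz; rewrite mulf_eq0 negb_or => /andP[-> ->]; rewrite h1 h2.
rewrite (big_rem z) //=; apply: ltr_pwDl => //.
by rewrite big_seq; apply: sumr_ge0 => y /mem_rem yW; apply: ge.
Qed.

End Orientation.

(** * Sign changes of annihilating measures *)

Section SignChanges.
Variables (R : realType) (a b : R) (n : nat) (u : nat -> R -> R).
Hypothesis hu : complete_chebyshev_set a b n u.
Hypothesis hab : a < b.

Lemma ordered_in_sort (W : seq R) : uniq W -> (forall z, z \in W -> a <= z <= b) ->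
  ordered_in a b (sort <=%R W).
Proof.
move=> uW hW; rewrite /ordered_in sort_lt_sorted uW; apply/allP => z.
by rewrite mem_sort => /hW.
Qed.

(** Zeros at all points of [W] but [z] leave a single term, and there are fewer than [m] of them, so
    the whole test combination is annihilated. *)
Lemma few_nodes_zero m (W : seq R) (g : R -> R) : (m <= n)%N -> uniq W ->
  (forall z, z \in W -> a <= z <= b) -> (size W <= m)%N ->
  (forall j, (j < m)%N -> \sum_(z <- W) g z * u j z = 0) ->
  forall z, z \in W -> g z = 0.
Proof.
move=> mn uW hW sW ann z zW; apply/eqP/negPn/negP => gz.
pose d := sort <=%R (rem z W).
have dm : (size d < m)%N.
  by rewrite size_sort size_rem // (leq_trans _ sW) // prednK //; case: (W) zW.
have gd : ordered_in a b d.
  by apply: ordered_in_sort; [exact: rem_uniq|move=> y /mem_rem; exact: hW].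
have zd : z \notin d by rewrite mem_sort mem_rem_uniqF.
have [||||_] := annihilator_sign (W := W) (g := g) (d := d)
  (kap := g z * (-1) ^+ count [pred x | x < z] d) hu hab gd.
- exact: leq_trans dm mn.
- exact: hW.
- by move=> j jd; apply: ann; apply: ltn_trans jd dm.
- move=> y yW; rewrite mem_sort mem_rem_uniq // !inE yW andbT negbK => /eqP->.
  by rewrite -mulrA mulrACA -!expr2 mulr_ge0 ?sqr_ge0.
rewrite ann // mulr0 ltxx => h; suff : false by []; apply: h; exists z; split=> //.
by rewrite !mulf_neq0 // signr_eq0.
Qed.

(** Zeros at all points of [W] but [x] and [y] number fewer than [m]; none lies between the two
    neighbours, so the test combination has the same sign at both. Values of [g] that do not have
    opposite signs must then vanish, and the remaining points are too few. *)
Lemma adjacent_zero m (W : seq R) (g : R -> R) x y : (m <= n)%N -> uniq W ->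
  (forall z, z \in W -> a <= z <= b) -> (size W <= m.+1)%N ->
  (forall j, (j < m)%N -> \sum_(z <- W) g z * u j z = 0) ->
  x \in W -> y \in W -> x < y -> (forall z, z \in W -> ~~ (x < z < y)) ->
  0 <= g x * g y -> forall z, z \in W -> g z = 0.
Proof.
move=> mn uW hW sW ann xW yW xy adj gxy.
have xyW : x \in rem y W by rewrite mem_rem_uniq // !inE xW (lt_eqF xy).
pose d := sort <=%R (rem x (rem y W)).
have sd : (size d).+2 = size W.
  rewrite size_sort size_rem // size_rem // !prednK //; first by case: (W) yW.
  by rewrite -(size_rem yW); case: (rem y W) xyW.
have dm : (size d < m)%N by rewrite -ltnS -ltnS sd.
have ud : uniq (rem x (rem y W)) by rewrite !rem_uniq.
have dW z : z \in d = [&& z != x, z != y & z \in W].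
  by rewrite mem_sort mem_rem_uniq ?rem_uniq // !inE mem_rem_uniq // !inE.
have gd : ordered_in a b d.
  by apply: ordered_in_sort => // z /mem_rem/mem_rem; exact: hW.
have cE : count [pred t | t < y] d = count [pred t | t < x] d.
  apply: eq_in_count => z; rewrite dW => /and3P[zx zy zW] /=.
  have [h|h] := ltP z x; first by rewrite (lt_trans h xy).
  have := adj z zW; rewrite lt_neqAle eq_sym zx h /= => /negPf //.
have gx0 : g x = 0 /\ g y = 0.
  apply: contrapT => hg.
  have hg2 : (g x != 0) || (g y != 0).
    by rewrite -negb_and; apply/negP => /andP[/eqP ? /eqP ?]; apply: hg.
  (* The factor [g x + g y] carries the common sign of both values, even if one of them is 0. *)
  have [||||_] := annihilator_sign (W := W) (g := g) (d := d)
    (kap := (g x + g y) * (-1) ^+ count [pred t | t < x] d) hu hab gd.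
  - exact: leq_trans dm mn.
  - exact: hW.
  - by move=> j jd; apply: ann; apply: ltn_trans jd dm.
  - move=> z zW; rewrite dW zW andbT negb_and !negbK.
    case/orP=> /eqP->; rewrite ?cE -mulrA mulrACA -expr2 sqrr_sign mulr1.
    - by rewrite mulrDl [g y * _]mulrC addr_ge0 // -expr2 sqr_ge0.
    - by rewrite mulrDl addr_ge0 // -expr2 sqr_ge0.
  rewrite ann // mulr0 ltxx => h'; suff : false by []; apply: h'.
  case/orP: hg2 => h; [exists x|exists y]; split; rewrite ?dW ?eqxx ?andbF //.
    have : 0 < (g x + g y) * g x.
      by rewrite mulrDl [g y * _]mulrC ltr_pwDl // -expr2 exprn_even_gt0.
    by move/lt0r_neq0; rewrite mulf_eq0 negb_or => /andP[? ?]; rewrite !mulf_neq0 ?signr_eq0.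
  have : 0 < (g x + g y) * g y.
    by rewrite mulrDl ltr_wpDl // -expr2 exprn_even_gt0.
  by move/lt0r_neq0; rewrite mulf_eq0 negb_or => /andP[? ?]; rewrite !mulf_neq0 ?signr_eq0.
have h0 : forall z, z \in rem x W -> g z = 0.
  apply: (@few_nodes_zero m); rewrite ?rem_uniq //.
  - by move=> z /mem_rem; exact: hW.
  - by rewrite size_rem // -subn1 leq_subLR add1n.
  move=> j /ann; rewrite (big_rem x) //=; case: gx0 => -> _.
  by rewrite mul0r add0r.
move=> z zW; have [->|zx] := eqVneq z x; first by case: gx0.
by apply: h0; rewrite mem_rem_uniq // !inE zx.
Qed.

(** With the [m] zeros at all points but the first, the tested sum reduces to the term at [x], where
    the sign of the combination is known. *)
Lemma first_node_sign m (W : seq R) (g : R -> R) x : (m < n)%N -> uniq W ->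
  (forall z, z \in W -> a <= z <= b) -> size W = m.+1 ->
  (forall j, (j < m)%N -> \sum_(z <- W) g z * u j z = 0) ->
  x \in W -> (forall z, z \in W -> x <= z) -> 0 < g x ->
  0 < osign a b u m * \sum_(z <- W) g z * u m z.
Proof.
move=> mn uW hW sW ann xW xmin gx.
pose d := sort <=%R (rem x W).
have sd : size d = m by rewrite size_sort size_rem // sW.
have gd : ordered_in a b d.
  by apply: ordered_in_sort; [exact: rem_uniq|move=> y /mem_rem; exact: hW].
have xd : x \notin d by rewrite mem_sort mem_rem_uniqF.
have c0 : count [pred t | t < x] d = 0%N.
  apply/eqP; rewrite -leqn0 leqNgt -has_count; apply/hasPn => z.
  by rewrite mem_sort => /mem_rem/xmin /=; rewrite leNgt.
have := annihilator_sign (W := W) (g := g) (d := d) (kap := 1) hu hab gd.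
rewrite sd mul1r => -[//|//|//||_]; last first.
  by apply; exists x; rewrite xd xW mul1r gt_eqF.
move=> y yW; rewrite mem_sort mem_rem_uniq // !inE yW andbT negbK => /eqP->.
by rewrite c0 mulr1 mul1r ltW.
Qed.

End SignChanges.

(** * Rules as finite measures *)

Section Mass.
Variables (R : realType).

(** Weights at coinciding nodes are added, since rules obtained by compactness need not have
    distinct nodes. *)
Definition mass N (r : rule R N) (z : R) : R :=
  \sum_(i < N) weight r i *+ (node r i == z).

Lemma quad_mass N (r : rule R N) (W : seq R) f : uniq W ->
  (forall i, node r i \in W) -> quad r f = \sum_(z <- W) mass r z * f z.
Proof.
move=> uW h; under eq_bigr do rewrite mulr_suml.
rewrite exchange_big /=; apply: eq_bigr => i _.
rewrite (big_rem (node r i)) //= eqxx mulr1n big_seq big1 ?addr0 // => z.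
by rewrite mem_rem_uniq // !inE => /andP[/negPf e _]; rewrite eq_sym e mulr0n mul0r.
Qed.

Lemma mass_notin N (r : rule R N) z : z \notin codom (node r) -> mass r z = 0.
Proof.
move=> h; apply: big1 => i _; case: eqP => // e.
by case/negP: h; rewrite -e codom_f.
Qed.

Lemma mass_node N (r : rule R N) i : injective (node r) ->
  mass r (node r i) = weight r i.
Proof.
move=> inj; rewrite /mass (bigD1 i) //= eqxx mulr1n big1 ?addr0 // => j ji.
by rewrite (inj_eq inj) (negPf ji).
Qed.

Lemma increasing_inj N (r : rule R N) : increasing_nodes r -> injective (node r).
Proof.
move=> h i j e; apply: val_inj; case: (ltngtP i j) => // /h; by rewrite e ltxx.
Qed.

Lemma mass_ge0 N (r : rule R N) z : (forall i, 0 <= weight r i) -> 0 <= mass r z.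
Proof. by move=> h; apply: sumr_ge0 => i _; rewrite mulrn_wge0. Qed.

(** Recovers a genuine support from an optimal rule, whose nodes may coincide and whose weights may
    vanish. *)
Lemma compress_rule N (r : rule R N) : (forall i, 0 <= weight r i) ->
  exists S, [/\ sorted <%R S, (size S <= N)%N,
    (forall z, (z \in S) = (0 < mass r z)) &
    forall f, quad r f = \sum_(z <- S) mass r z * f z].
Proof.
move=> w0; pose W := undup (codom (node r)).
have uW : uniq W by exact: undup_uniq.
have uS : uniq [seq z <- W | 0 < mass r z] by rewrite filter_uniq.
exists (sort <=%R [seq z <- W | 0 < mass r z]); split.
- by rewrite sort_lt_sorted.
- rewrite size_sort size_filter; apply: leq_trans (count_size _ _) _.
  by apply: leq_trans (size_undup _) _; rewrite size_codom card_ord.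
- move=> z; rewrite mem_sort mem_filter mem_undup.
  by have [//|/mass_notin ->] := boolP (z \in codom (node r)); rewrite ?andbT // ltxx.
move=> f; rewrite (quad_mass f uW) => [|i]; last by rewrite mem_undup codom_f.
rewrite (perm_big _ (permEl (perm_sort _ _))) big_filter [RHS]big_mkcond.
apply: eq_bigr => z _; case: ltP => // h.
suff -> : mass r z = 0 by rewrite mul0r.
by apply/eqP; rewrite eq_le h mass_ge0.
Qed.

Lemma mass_gt0_in N (r : rule R N) z : 0 < mass r z -> z \in codom (node r).
Proof. by apply: contraTT => /mass_notin ->; rewrite ltxx. Qed.

Lemma mass_diff N1 N2 (r1 : rule R N1) (r2 : rule R N2) u c m (W : seq R) :
  uniq W -> {subset codom (node r1) <= W} -> {subset codom (node r2) <= W} ->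
  exact_for u c m r1 -> exact_for u c m r2 ->
  forall j, (j < m)%N -> \sum_(z <- W) (mass r1 z - mass r2 z) * u j z = 0.
Proof.
move=> uW h1 h2 e1 e2 j jm; under eq_bigr do rewrite mulrBl.
rewrite sumrB -!quad_mass // => [|i|i]; first by rewrite e1 // e2 // subrr.
- by apply: h2; exact: codom_f.
- by apply: h1; exact: codom_f.
Qed.

(** The list [L] may contain repetitions; it only certifies that the two node sets together have at
    most [m] points. *)
Lemma mass_eq a b n (u : nat -> R -> R) c m N1 N2 (r1 : rule R N1) (r2 : rule R N2) (L : seq R) :
  complete_chebyshev_set a b n u -> a < b -> (m <= n)%N ->
  exact_for u c m r1 -> exact_for u c m r2 ->
  (forall i, a <= node r1 i <= b) -> (forall i, a <= node r2 i <= b) ->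
  {subset codom (node r1) <= L} -> {subset codom (node r2) <= L} ->
  (size L <= m)%N -> mass r1 =1 mass r2.
Proof.
move=> hu hab mn e1 e2 h1 h2 s1 s2 sL z.
pose W := undup (codom (node r1) ++ codom (node r2)).
have w1 : {subset codom (node r1) <= W} by move=> y h; rewrite mem_undup mem_cat h.
have w2 : {subset codom (node r2) <= W} by move=> y h; rewrite mem_undup mem_cat h orbT.
have [zW|] := boolP (z \in W); last first.
  rewrite mem_undup mem_cat negb_or => /andP[/mass_notin -> /mass_notin ->] //.
apply/eqP; rewrite -subr_eq0; apply/eqP; move: z zW.
apply: (few_nodes_zero hu hab mn); rewrite ?undup_uniq //.
- move=> z; rewrite mem_undup mem_cat => /orP[] /codomP[i ->] //.
- apply: leq_trans sL; apply: uniq_leq_size; rewrite ?undup_uniq // => z.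
  by rewrite mem_undup mem_cat => /orP[/s1|/s2].
- exact: (mass_diff (undup_uniq _) w1 w2 e1 e2).
Qed.

End Mass.

(** * Uniqueness and monotonicity of rules with prescribed first node *)

Section Rules.
Variable R : realType.

Lemma rule_eq N (r1 r2 : rule R N) : node r1 =1 node r2 -> weight r1 =1 weight r2 ->
  r1 = r2.
Proof. by case: r1 r2 => [x1 w1] [x2 w2] /= /funext-> /funext->. Qed.

Lemma increasing_le N (r : rule R N) (i j : 'I_N) : increasing_nodes r ->
  (i <= j)%N -> node r i <= node r j.
Proof.
move=> h; rewrite leq_eqVlt => /orP[/eqP/val_inj->//|/h/ltW//].
Qed.

Lemma sorted_codom N (e : rel R) (f : 'I_N -> R) :
  (forall i j : 'I_N, (i < j)%N -> e (f i) (f j)) -> sorted e (codom f).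
Proof.
move=> h; rewrite /codom /image_mem sorted_map.
apply: (@sub_sorted _ (relpre val ltn)) => [i j|]; first exact: h.
by rewrite -sorted_map val_enum_ord iota_ltn_sorted.
Qed.

(** Pigeonhole: [g] takes [N] distinct values among the values of [f], so both have the same ones,
    in the same order. Only weak monotonicity of [f] is asked, so that [f] may come from a limit
    rule. *)
Lemma sorted_codom_eq N (f g : 'I_N -> R) :
  (forall i j : 'I_N, (i < j)%N -> f i <= f j) ->
  (forall i j : 'I_N, (i < j)%N -> g i < g j) ->
  {subset codom g <= codom f} -> f =1 g.
Proof.
move=> hf hg hs; have ug : uniq (codom g) by apply: lt_sorted_uniq; exact: sorted_codom.
have ss : (size (codom f) <= size (codom g))%N by rewrite !size_codom.
have [uf eqfg] := uniq_min_size ug hs ss.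
have ucf : uniq (codom f) by rewrite -(eq_uniq uf eqfg).
have pfg : perm_eq (codom f) (codom g).
  apply: uniq_perm => // z; rewrite eqfg.
have : codom f = codom g.
  apply: (sorted_eq (@le_trans _ R)) => //; first exact: le_anti.
    exact: sorted_codom.
  by apply: sorted_codom => i j ij; apply/ltW/hg.
move/eq_in_map => h i; apply: h; exact: mem_enum.
Qed.

End Rules.

Section Canonical.
Variables (R : realType) (a b : R) (n : nat) (u : nat -> R -> R) (c : nat -> R).
Hypothesis hu : complete_chebyshev_set a b n u.
Hypothesis hab : a < b.
Variables (o : bool) (k : nat).
Hypothesis ko : (0 < k + o)%N.

(* Common to the rules of the family with parameter [xi] and to its final
   member: for [o = false] the last node is [b] and may carry any weight. *)
Definition semicanonical (xi : R) (r : rule R k.+1) : Prop :=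
  [/\ node r ord0 = xi, increasing_nodes r,
      (if o then is_true (node r ord_max <= b) else node r ord_max = b),
      (forall i : 'I_k.+1, (i < k + o)%N -> 0 < weight r i) &
      exact_for u c (2 * k + o) r].

Lemma semicanonical_in xi r : a <= xi -> semicanonical xi r ->
  forall i, a <= node r i <= b.
Proof.
move=> axi [r0 inc rm _ _] i; apply/andP; split.
  by apply: le_trans axi _; rewrite -r0; exact: increasing_le.
have : node r i <= node r ord_max by apply: increasing_le => //; exact: leq_ord.
by move/le_trans; apply; move: rm; case: (o) => // ->.
Qed.

(** Little is asked of [r1], because it will be a limit of rules: its nodes might merge and its
    weights have no sign condition. Besides the [k + 1] nodes of [r1], the rule [r2] contributes at
    most [k + o - 1] new points, as its first node, and its last one when [o] is false, are shared;
    this makes [2 * k + o] in all. *)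
Lemma semicanonical_eq xi (r1 r2 : rule R k.+1) : (2 * k + o <= n)%N -> a <= xi ->
  semicanonical xi r2 -> exact_for u c (2 * k + o) r1 ->
  (forall i, a <= node r1 i <= b) ->
  (forall i j : 'I_k.+1, (i < j)%N -> node r1 i <= node r1 j) ->
  node r1 ord0 = xi -> (~~ o -> node r1 ord_max = b) -> r1 = r2.
Proof.
move=> kn axi s2 e1 in1 nd1 r10 r1m.
have [r20 inc2 r2m pos2 e2] := s2.
pose L := codom (node r1) ++ [seq node r2 (inord i) | i <- iota 1 (k + o).-1].
have freeP (i : 'I_k.+1) : (i < k + o)%N \/ ~~ o /\ i = ord_max.
  have [|h] := ltnP i (k + o); [by left|right].
  have := ltn_ord i; rewrite ltnS leq_eqVlt => /orP[/eqP ik|ik]; last first.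
    by move: h; rewrite leqNgt (leq_trans ik) ?leq_addr.
  split; last exact/val_inj.
  by apply/negP => ho; move: h; rewrite ho ik addn1 ltnn.
have sub2 : {subset codom (node r2) <= L}.
  move=> _ /codomP[i ->]; rewrite mem_cat.
  have [i0|i0] := posnP i.
    have -> : i = ord0 by exact/val_inj.
    by rewrite r20 -r10 codom_f.
  have [h|[no ->]] := freeP i; last first.
    by move: r2m; rewrite (negPf no) => ->; rewrite -(r1m no) codom_f.
  apply/orP; right; apply/mapP; exists (i : nat); last by rewrite inord_val.
  by rewrite mem_iota i0 add1n prednK.
have mE : mass r1 =1 mass r2.
  apply: (mass_eq hu hab kn e1 e2 in1 (semicanonical_in axi s2) _ sub2).
    by move=> z h; rewrite mem_cat h.
  rewrite size_cat size_codom card_ord size_map size_iota addSnnS prednK //.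
  by rewrite addnA addnn mul2n.
(* A node of [r2] with positive weight has positive mass, hence is a node of [r1]; the only other
   possible one is [b], prescribed in both. *)
have nE : node r1 =1 node r2.
  apply: sorted_codom_eq => // _ /codomP[i ->].
  have [h|[no ->]] := freeP i; last first.
    by move: r2m; rewrite (negPf no) => ->; rewrite -(r1m no) codom_f.
  apply: contraT => /mass_notin; rewrite mE mass_node; last exact: increasing_inj.
  by move/eqP; rewrite gt_eqF // pos2.
apply: rule_eq => // i.
have inc1 : increasing_nodes r1 by move=> p q /inc2; rewrite !nE.
rewrite -(mass_node _ (increasing_inj inc1)) -(mass_node _ (increasing_inj inc2)).
by rewrite mE nE.
Qed.

Lemma semicanonical_uniq xi r1 r2 : (2 * k + o <= n)%N -> a <= xi ->
  semicanonical xi r1 -> semicanonical xi r2 -> r1 = r2.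
Proof.
move=> kn axi s1 s2; have [r10 inc1 r1m _ e1] := s1.
apply: (semicanonical_eq kn axi s2) => //.
- exact: semicanonical_in s1.
- by move=> i j /inc1/ltW.
- by move: r1m; case: (o).
Qed.

(** * Two members of the family *)

Section Compare.
Variables (xi xi' : R) (r r' : rule R k.+1).
Hypotheses (kn : (2 * k + o <= n)%N) (axi : a <= xi) (lt_xi : xi < xi').
Hypotheses (sr : semicanonical xi r) (sr' : semicanonical xi' r').

(** When [o] is false, the common last node is listed once. The list thus has [2 * k + o + 1]
    entries, one more than uniqueness allows, which is the number at which the difference must
    alternate. *)
Let W := codom (node r) ++ [seq node r' (inord i) | i <- iota 0 (k + o)].
Let g z := mass r z - mass r' z.

Let inc : increasing_nodes r. Proof. by case: sr. Qed.
Let inc' : increasing_nodes r'. Proof. by case: sr'. Qed.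
Let r0 : node r ord0 = xi. Proof. by case: sr. Qed.
Let r0' : node r' ord0 = xi'. Proof. by case: sr'. Qed.
Let er : exact_for u c (2 * k + o) r. Proof. by case: sr. Qed.
Let er' : exact_for u c (2 * k + o) r'. Proof. by case: sr'. Qed.
Let axi' : a <= xi'. Proof. exact: le_trans axi (ltW lt_xi). Qed.
Let inab := semicanonical_in axi sr.
Let inab' := semicanonical_in axi' sr'.

Let sW : size W = (2 * k + o).+1.
Proof.
rewrite size_cat size_codom card_ord size_map size_iota addSn addnA addnn.
by rewrite mul2n.
Qed.

Let W1 : {subset codom (node r) <= W}.
Proof. by move=> z h; rewrite mem_cat h. Qed.

Let lastE : ~~ o -> node r ord_max = node r' ord_max.
Proof. by move=> no; case: sr sr' => _ _ + _ _ [_ _ + _ _]; rewrite (negPf no) => -> ->. Qed.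

Let W2 : {subset codom (node r') <= W}.
Proof.
move=> _ /codomP[i ->]; rewrite mem_cat.
have [h|h] := ltnP i (k + o).
  apply/orP; right; apply/mapP; exists (i : nat); last by rewrite inord_val.
  by rewrite mem_iota.
have ik : i = ord_max.
  by apply: val_inj => /=; have := ltn_ord i; rewrite ltnS; lia.
have no : ~~ o by apply/negP => ho; move: h; rewrite ik ho /= addn1 ltnn.
by rewrite ik -(lastE no) codom_f.
Qed.

Let xi_lt z : z \in codom (node r') -> xi < z.
Proof.
move=> /codomP[i ->]; apply: lt_le_trans lt_xi _; rewrite -r0'.
exact: increasing_le.
Qed.

Let gxi : 0 < g xi.
Proof.
rewrite /g [X in _ - X]mass_notin ?subr0; last by apply/negP => /xi_lt; rewrite ltxx.
rewrite -r0 mass_node; last exact: increasing_inj.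
by case: sr => _ _ _ pos _; exact: pos.
Qed.

(** A further common node would leave at most [2 * k + o] points, so the two measures would agree,
    against the positive difference at [xi]. *)
Let uW : uniq W.
Proof.
apply/negPn/negP => nu; move: gxi; rewrite /g.
rewrite (mass_eq (L := undup W) hu hab kn er er' inab inab') ?subrr ?ltxx //.
- by move=> z /W1; rewrite mem_undup.
- by move=> z /W2; rewrite mem_undup.
- by rewrite -ltnS -sW ltn_size_undup.
Qed.

Let inW z : z \in W -> a <= z <= b.
Proof.
by rewrite mem_cat => /orP[/codomP[i ->]|/mapP[i _ ->]]; [exact: inab|exact: inab'].
Qed.

Let annW := mass_diff uW W1 W2 er er'.

(** The leftmost point of the union is [xi], and only [r] has mass there. *)
Lemma semicanonical_quad_lt : (2 * k + o < n)%N ->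
  0 < osign a b u (2 * k + o) *
      (quad r (u (2 * k + o)%N) - quad r' (u (2 * k + o)%N)).
Proof.
move=> kn'.
have xiW : xi \in W by apply: W1; rewrite -r0 codom_f.
have := @first_node_sign _ a b n u hu hab (2 * k + o) W g xi kn' uW inW sW annW xiW.
rewrite (@quad_mass _ _ r W _ uW); last by move=> i; apply: W1; exact: codom_f.
rewrite (@quad_mass _ _ r' W _ uW); last by move=> i; apply: W2; exact: codom_f.
rewrite -sumrB; under eq_bigr do rewrite mulrBl; apply => // z.
rewrite mem_cat => /orP[/codomP[i ->]|/mapP[i _ ->]]; last by apply/ltW/xi_lt/codom_f.
by rewrite -r0; exact: increasing_le.
Qed.

Let x i := node r (inord i).
Let x' i := node r' (inord i).

Let xlt i j : (i < j <= k)%N -> x i < x j.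
Proof. by move=> /andP[ij jk]; apply: inc; rewrite !inordK //; lia. Qed.

Let x'lt i j : (i < j <= k)%N -> x' i < x' j.
Proof. by move=> /andP[ij jk]; apply: inc'; rewrite !inordK //; lia. Qed.

Let xle i j : (i <= j <= k)%N -> x i <= x j.
Proof. by move=> /andP[ij jk]; apply: increasing_le => //; rewrite !inordK //; lia. Qed.

Let x'le i j : (i <= j <= k)%N -> x' i <= x' j.
Proof. by move=> /andP[ij jk]; apply: increasing_le => //; rewrite !inordK //; lia. Qed.

Let disj i j : (i < k + o)%N -> x j != x' i.
Proof.
move=> ik; move: uW; rewrite cat_uniq => /and3P[_ /hasPn h _].
apply/eqP => e; have := h (x' i).
rewrite -e /= codom_f e => h2; suff : ~~ true by []; apply: h2.
by apply/mapP; exists i; rewrite ?mem_iota.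
Qed.

Let gx i : (i < k + o)%N -> (i <= k)%N -> 0 < g (x i).
Proof.
move=> ik ik'; rewrite /g [X in _ - X]mass_notin ?subr0; last first.
  apply/negP => /codomP[j e].
  have [h|h] := ltnP j (k + o); first by have := disj i h; rewrite /x' inord_val -e eqxx.
  have jk : j = ord_max by apply: val_inj => /=; have := ltn_ord j; rewrite ltnS; lia.
  have no : ~~ o by apply/negP => ho; move: h; rewrite jk ho /= addn1 ltnn.
  move: e; rewrite jk -(lastE no) => /(increasing_inj inc)/(congr1 val) /=.
  by rewrite inordK // => e; move: ik; rewrite e (negPf no) addn0 ltnn.
rewrite mass_node; last exact: increasing_inj.
by case: sr => _ _ _ pos _; apply: pos; rewrite inordK.
Qed.

Let gx' i : (i < k + o)%N -> (i <= k)%N -> g (x' i) < 0.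
Proof.
move=> ik ik'; rewrite /g [X in X - _]mass_notin ?sub0r; last first.
  by apply/negP => /codomP[j e]; have := disj j ik; rewrite /x inord_val -e eqxx.
rewrite oppr_lt0 mass_node; last exact: increasing_inj.
by case: sr' => _ _ _ pos _; apply: pos; rewrite inordK.
Qed.

Let WP z : z \in W -> (exists2 j, (j <= k)%N & z = x j) \/
  (exists2 j, (j < k + o)%N && (j <= k)%N & z = x' j).
Proof.
rewrite mem_cat => /orP[/codomP[i ->]|/mapP[i]].
  by left; exists (i : nat); rewrite ?leq_ord // /x inord_val.
rewrite mem_iota /= add0n => ik ->; right; exists i => //.
by rewrite ik /=; move: ik; case: (o); lia.
Qed.

Let noadj p q : p \in W -> q \in W -> p < q -> 0 <= g p * g q ->
  exists2 z, z \in W & p < z < q.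
Proof.
move=> pW qW pq gpq; apply: contrapT => h.
have xiW : xi \in W by apply: W1; rewrite -r0 codom_f.
have h' z : z \in W -> ~~ (p < z < q) by move=> zW; apply/negP => hz; apply: h; exists z.
have := adjacent_zero hu hab kn uW inW _ annW pW qW pq h' gpq.
by rewrite sW => /(_ (leqnn _) xi xiW) e; move: gxi; rewrite /g e ltxx.
Qed.

Let xW i : x i \in W. Proof. exact/W1/codom_f. Qed.
Let x'W i : x' i \in W. Proof. exact/W2/codom_f. Qed.

(* The induction from the left also carries the other half of the interlacing. *)
Lemma semicanonical_node_lt (i : 'I_k.+1) : (i < k + o)%N -> node r i < node r' i.
Proof.
suff H j : (j <= k)%N -> (j < k + o)%N ->
    x j < x' j /\ (forall p, (p < j)%N -> x' p < x p.+1).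
  by move=> ik; have [] := H _ (leq_ord i) ik; rewrite /x /x' inord_val.
elim: j => [_ _|j IH jk jko].
  have -> : x 0 = xi by rewrite -r0; congr (node r _); apply/val_inj; rewrite /= inordK.
  by split=> //; apply: xi_lt; exact: codom_f.
have [h1 h2] := IH (ltnW jk) (ltnW jko).
have step p : (p < j.+1)%N -> x' p < x p.+1.
  rewrite ltnS leq_eqVlt => /orP[/eqP->|]; last exact: h2.
  (* Otherwise [x j] and [x j.+1] would be consecutive in [W], both with positive difference. *)
  rewrite ltNge le_eqVlt (negPf (disj _ (ltnW jko))) /=; apply/negP => lt1.
  have xj : x j < x j.+1 by apply: xlt; rewrite ltnSn.
  have [||||z /WP zW /andP[z1 z2]] := @noadj (x j) (x j.+1); rewrite ?xW //.
    exact/ltW/(mulr_gt0 (gx (ltnW jko) (ltnW jk)) (gx jko jk)).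
  case: zW => [[q qk e]|[q /andP[qko qk] e]]; subst z.
    have q1 : (j < q)%N.
      rewrite ltnNge; apply: contraTN z1 => le; rewrite -leNgt.
      by apply: xle; rewrite le ltnW.
    have : (q < j.+1)%N.
      rewrite ltnNge; apply: contraTN z2 => le; rewrite -leNgt.
      by apply: xle; rewrite le.
    by rewrite ltnS leqNgt q1.
  have qj : (q < j)%N.
    rewrite ltnNge; apply: contraTN (lt_trans z2 lt1) => le; rewrite -leNgt.
    by apply: x'le; rewrite le.
  have := lt_le_trans (lt_trans z1 (h2 _ qj)) (_ : x q.+1 <= x j).
  rewrite ltxx => h; suff : false by []; apply: h.
  by apply: xle; rewrite qj ltnW.
split=> //.
(* Otherwise [x' j] and [x' j.+1] would be consecutive in [W], both with negative difference. *)
rewrite ltNge le_eqVlt eq_sym (negPf (disj _ jko)) /=; apply/negP => lt1.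
have xj : x' j < x' j.+1 by apply: x'lt; rewrite ltnSn.
have [||||z /WP zW /andP[z1 z2]] := @noadj (x' j) (x' j.+1); rewrite ?x'W //.
  by rewrite -mulrNN; apply/ltW/mulr_gt0; rewrite oppr_gt0 gx' // ltnW.
case: zW => [[q qk e]|[q /andP[qko qk] e]]; subst z.
  have qj : (q < j.+1)%N.
    rewrite ltnNge; apply: contraTN (lt_trans z2 lt1) => le; rewrite -leNgt.
    by apply: xle; rewrite le.
  have := lt_le_trans (lt_trans h1 z1) (_ : x q <= x j).
  rewrite ltxx => h; suff : false by []; apply: h.
  by apply: xle; rewrite -ltnS qj ltnW.
have q1 : (j < q)%N.
  rewrite ltnNge; apply: contraTN z1 => le; rewrite -leNgt.
  by apply: x'le; rewrite le ltnW.
have : (q < j.+1)%N.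
  rewrite ltnNge; apply: contraTN z2 => le; rewrite -leNgt.
  by apply: x'le; rewrite le.
by rewrite ltnS leqNgt q1.
Qed.

End Compare.
End Canonical.

(** * Splitting nodes into close pairs *)

Section FiniteSums.
Variable R : realType.
Implicit Types (d S : seq R) (f g : R -> R).

Lemma seq_lower_bound (T : eqType) (s : seq T) (h : T -> R) :
  (forall z, z \in s -> 0 < h z) ->
  exists2 e, 0 < e & forall z, z \in s -> e <= h z.
Proof.
elim: s => [|x s IH] hs; first by exists 1.
have [|e e0 he] := IH; first by move=> z zs; apply: hs; rewrite inE zs orbT.
exists (Num.min e (h x)).
  by rewrite lt_min e0 hs // mem_head.
move=> z; rewrite inE => /orP[/eqP->|/he h1]; first by rewrite ge_min lexx orbT.
by rewrite ge_min h1.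
Qed.

Lemma seq_gap (s : seq R) : exists2 e, 0 < e &
  forall x y, x \in s -> y \in s -> x < y -> x + e < y.
Proof.
have [|e e0 he] := @seq_lower_bound _ [seq (x, y) | x <- s, y <- s]
  (fun p => if p.1 < p.2 then (p.2 - p.1) / 2 else 1).
  by move=> [x y] _ /=; case: (ltP x y) => xy; rewrite ?ltr01 // divr_gt0 // subr_gt0.
exists e => // x y xs ys xy; have := he (x, y); rewrite /= xy => h.
have /h h1 : (x, y) \in [seq (x, y) | x <- s, y <- s] by apply/allpairsP; exists (x, y).
by lra.
Qed.

(** Padding with weight 0 brings rules with fewer nodes into a box of fixed dimension. *)
Lemma sum_nth_pad N d g f x0 : (size d <= N)%N ->
  \sum_(i < N) nth 0 (map g d) i * f (nth x0 d i) = \sum_(z <- d) g z * f z.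
Proof.
move=> dN; rewrite -(big_mkord xpredT (fun i => nth 0 (map g d) i * f (nth x0 d i))).
rewrite (big_cat_nat (n := size d)) //= [X in _ + X]big_nat_cond.
rewrite [X in _ + X]big1 ?addr0.
  rewrite [RHS](big_nth x0) big_nat_cond [RHS]big_nat_cond.
  apply: eq_bigr => i /andP[/andP[_ id] _]; by rewrite (nth_map x0).
by move=> i /andP[/andP[di _] _]; rewrite nth_default ?size_map // mul0r.
Qed.

Lemma sum_subset d S f : uniq d -> uniq S -> {subset S <= d} ->
  \sum_(z <- d) (if z \in S then f z else 0) = \sum_(z <- S) f z.
Proof.
move=> ud uS Sd; rewrite -big_mkcond -big_filter; apply: perm_big.
apply: uniq_perm => //; first exact: filter_uniq.
by move=> z; rewrite mem_filter; case: (boolP (z \in S)) => // /Sd ->.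
Qed.

Definition seqrule N d g : rule R N := Rule (fun i : 'I_N => nth 0 d i)
  (fun i => g (nth 0 d i)).

Lemma quad_seqrule N d g f : size d = N -> quad (seqrule N d g) f = \sum_(z <- d) g z * f z.
Proof.
move=> <-; rewrite (big_nth 0) big_mkord; by apply: eq_bigr.
Qed.

Lemma seqrule_in N d g i : size d = N -> node (seqrule N d g) i \in d.
Proof. by move=> sd; apply: mem_nth; rewrite sd. Qed.

Lemma seqrule_increasing N d g : size d = N -> sorted <%R d ->
  increasing_nodes (seqrule N d g).
Proof. by move=> sd so i j ij; rewrite /= lt_sorted_ltn_nth // inE sd. Qed.

Lemma mass_seqrule N d g z : size d = N -> uniq d -> z \in d ->
  mass (seqrule N d g) z = g z.
Proof.
move=> sd ud zd; have zN : (index z d < N)%N by rewrite -sd index_mem.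
have := @mass_node _ N (seqrule N d g) (Ordinal zN).
rewrite /= !nth_index //; apply.
move=> i j /= /eqP; rewrite nth_uniq ?sd // => /eqP; exact: val_inj.
Qed.

Lemma codom_seqrule N d g : size d = N -> {subset codom (node (seqrule N d g)) <= d}.
Proof. by move=> sd _ /codomP[i ->]; exact: seqrule_in. Qed.

End FiniteSums.

Section Doubling.
Variable R : realType.
Implicit Types (s : seq R) (e : R).

(** The pair [x], [x + e] stands for a double zero at [x]: a test combination has the same sign on
    both sides of it. *)
Definition twin e s := flatten [seq [:: x; x + e] | x <- s].

Lemma size_twin e s : size (twin e s) = (2 * size s)%N.
Proof. by elim: s => //= x s ->; rewrite mulnS. Qed.

Lemma mem_twin e s (z : R) : (z \in twin e s) = (z \in s) || (z - e \in s).
Proof.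
elim: s => //= x s IH; rewrite !inE IH -(subr_eq z x e) orbA orbACA.
by rewrite -!orbA.
Qed.

Lemma count_twin e s (P : pred R) :
  count P (twin e s) = (count P s + count (fun x => P (x + e)%R) s)%N.
Proof. by elim: s => //= x s ->; lia. Qed.

Lemma sorted_twin e s1 s2 : 0 < e ->
  (forall x y, x \in s1 -> y \in s1 ++ s2 -> x < y -> x + e < y) ->
  sorted <%R (s1 ++ s2) -> sorted <%R (twin e s1 ++ s2).
Proof.
move=> e0; elim: s1 => //= x s1 IH hs; rewrite !lt_path_sortedE.
move=> /andP[/allP xl so].
have hx y : y \in s1 ++ s2 -> x + e < y.
  by move=> ys; apply: hs; rewrite ?inE ?eqxx ?ys ?orbT //; exact: xl.
rewrite IH ?andbT //; last by move=> p q ps qs; apply: hs; rewrite inE ?ps ?qs orbT.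
have hx' : all [pred y | x + e < y] (twin e s1 ++ s2).
  apply/allP => y; rewrite mem_cat mem_twin /=.
  case/orP=> [/orP[ys|ys]|ys]; try by apply: hx; rewrite mem_cat ys ?orbT.
  have := hx (y - e); rewrite mem_cat ys => /(_ isT); lra.
by rewrite -/(twin e s1) [X in _ && X]hx' ltrDl e0.
Qed.

Lemma count_twin_lt e s z : (forall x, x \in s -> (x + e < z) = (x < z)) ->
  count [pred x | x < z] (twin e s) = (2 * count [pred x | (x < z)%R] s)%N.
Proof.
move=> h; rewrite count_twin mul2n -addnn; congr addn.
by apply: eq_in_count => x /h.
Qed.

(** Every earlier pair counts twice, and the partner [x] counts once. *)
Lemma count_twin_mid e s x : 0 < e -> uniq s -> x \in s ->
  (forall y, y \in s -> x < y -> x + e < y) ->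
  odd (count [pred t | t < x + e] (twin e s)).
Proof.
move=> e0 us xs h; rewrite count_twin.
have -> : count (fun t => [pred t | t < x + e] (t + e)) s = count [pred t | t < x] s.
  by apply: eq_count => t /=; rewrite ltrD2r.
have -> : count [pred t | t < x + e] s = (count [pred t | (t < x)%R] s + 1)%N.
  rewrite -[1%N]/(true : nat) -xs -(count_uniq_mem x us).
  rewrite -count_predUI [X in (_ + X)%N](eq_count (a2 := pred0)) ?count_pred0 ?addn0; last first.
    by move=> t /=; case: eqP => [->|]; rewrite ?ltxx ?andbF.
  apply: eq_in_count => t ts /=.
  case: (ltgtP t x) => [tx|xt|->]; rewrite ?orbT //=; last by rewrite ltrDl.
  - by rewrite (lt_trans tx) // ltrDl.
  - by rewrite ltNge ltW // h.
by lia.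
Qed.

End Doubling.

Section Improvement.
Variables (R : realType) (a b : R) (n : nat) (u : nat -> R -> R).
Hypothesis hu : complete_chebyshev_set a b n u.
Hypothesis hab : a < b.

(** The solution [g] has no definite sign; it serves as a direction in which a positive rule is
    perturbed. *)
Lemma evdet_solve d (t : nat -> R) : ordered_in a b d -> (size d <= n)%N ->
  exists g : R -> R, forall j, (j < size d)%N -> \sum_(z <- d) g z * u j z = t j.
Proof.
move=> gd dn; have [_ ud _] := ordered_inP gd.
set m := size d; pose A := \matrix_(i < m, j < m) u i (nth 0 d j).
have uA : A \in unitmx by rewrite unitmxE unitfE; exact: (evdet_neq0 hu).
pose v : 'cV[R]_m := invmx A *m \col_i t i.
exists (fun z => if insub (index z d) is Some i then v i ord0 else 0) => j jm.
have -> : t j = (A *m v) (Ordinal jm) ord0 by rewrite mulKVmx // mxE.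
rewrite mxE (big_nth 0) big_mkord; apply: eq_bigr => i _.
by rewrite index_uniq // (valK i) [A _ _]mxE mulrC.
Qed.

(* The extra point [xi] lies to the left of the [m] points of [d], so its
   expansion in the corresponding values alternates in sign; every new point
   [x + e] receives a positive coefficient, whatever happens at the points of
   positive weight. *)
Lemma increase_first_weight m c xi lam (S : seq R) (g : R -> R) :
  (m <= n)%N -> a <= xi -> xi <= b ->
  sorted <%R S -> (forall z, z \in S -> xi < z <= b) ->
  (forall z, z \in S -> 0 < g z) ->
  (forall j, (j < m)%N -> lam * u j xi + \sum_(z <- S) g z * u j z = c j) ->
  (size S <= m)%N -> (m - size S <= size S)%N ->
  (forall z, z \in take (m - size S) S -> z < b) ->
  exists eps d g', [/\ 0 < eps, size d = m,
    (forall z, z \in d -> xi <= z <= b /\ 0 <= g' z) &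
    forall j, (j < m)%N ->
      (lam + eps) * u j xi + \sum_(z <- d) g' z * u j z = c j].
Proof.
move=> mn axi xib so hS gpos hc Sm qS tb; set q := (m - size S)%N in qS tb.
have [e e0 gap] := seq_gap (b :: S).
have tS z : z \in take q S -> z \in S by exact: mem_take.
(* Splitting [q = m - size S] points gives exactly [m]. The leftmost ones are split, since a last
   point equal to [b] leaves no room on its right. *)
pose d := twin e (take q S) ++ drop q S.
have uS := lt_sorted_uniq so.
have gapT x : x \in take q S -> forall y, y \in S -> x < y -> x + e < y.
  by move=> xt y yS; apply: gap; rewrite inE ?yS ?(tS _ xt) orbT.
have sod : sorted <%R d.
  apply: sorted_twin => //; last by rewrite cat_take_drop.
  by move=> x y xt; rewrite cat_take_drop => yS; exact: gapT.
have dP z : z \in d -> z \in S \/ exists2 x, x \in take q S & z = x + e.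
  rewrite mem_cat mem_twin => /orP[/orP[/tS|zt]|/mem_drop]; [by left| |by left].
  by right; exists (z - e) => //; rewrite subrK.
have Sd : {subset S <= d}.
  move=> z; rewrite -{1}(cat_take_drop q S) !mem_cat mem_twin => /orP[->//|->].
  by rewrite orbT.
have sd : size d = m.
  by rewrite size_cat size_twin size_takel // size_drop mul2n -addnn -addnA subnKC // subnK.
have din z : z \in d -> xi < z <= b.
  case/dP => [/hS //|[x xt ->]]; have /andP[x1 x2] := hS _ (tS _ xt).
  rewrite (lt_trans x1) ?ltrDl //= ltW //; apply: gap; rewrite ?inE ?eqxx ?(tS _ xt) ?orbT //.
  exact: tb.
have gd : ordered_in a b d.
  rewrite /ordered_in sod; apply/allP => z /din /andP[/ltW/(le_trans axi) h1 h2] /=.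
  by rewrite h1.
have [_ ud dab] := ordered_inP gd.
have [|be hbe] := evdet_solve (d := d) (fun j => - u j xi) gd; first by rewrite sd.
have xid : xi \notin d by apply/negP => /din; rewrite ltxx.
pose sg z := if z == xi then 1 else be z.
have sgd z : z \in d -> sg z = be z.
  by rewrite /sg; case: eqP => // ->; rewrite (negPf xid).
have ann j : (j < m)%N -> \sum_(z <- xi :: d) sg z * u j z = 0.
  move=> jm; rewrite big_cons {1}/sg eqxx mul1r.
  rewrite (eq_big_seq (fun z => be z * u j z)) ?hbe ?sd ?subrr //.
  by move=> z /sgd ->.
(* Off the zeros [rem y d], the annihilating measure [sg] has only the points [xi] and [y],
   separated by an odd number of zeros. If [be y] were negative, both contributions would be
   nonnegative and that of [xi] positive. *)
have bepos x : x \in take q S -> 0 <= be (x + e).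
  move=> xt; rewrite leNgt; apply/negP => neg; set y := x + e in neg.
  have yd : y \in d by rewrite mem_cat mem_twin addrK xt orbT.
  have sdy : (size (rem y d)).+1 = m.
    by rewrite size_rem // sd prednK // -sd; case: (d) yd.
  have godd : odd (count [pred t | t < y] (rem y d)).
    have -> : count [pred t | t < y] (rem y d) = count [pred t | t < y] d.
      by rewrite (seq.permP (perm_to_rem yd)) /= ltxx.
    rewrite count_cat oddD count_twin_mid //; last 2 first.
    - exact: take_uniq.
    - by move=> z /tS; exact: gapT.
    suff -> : count [pred t | t < y] (drop q S) = 0%N by [].
    apply/eqP; rewrite -leqn0 leqNgt -has_count; apply/hasPn => z zd /=.
    rewrite -leNgt ltW // /y; apply: gapT => //; first exact: mem_drop zd.
    move: so; rewrite -{1}(cat_take_drop q S) lt_sorted_pairwise pairwise_cat.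
    by case/and3P=> /allrelP h _ _; exact: h.
  have gdy : ordered_in a b (rem y d).
    rewrite /ordered_in (subseq_sorted lt_trans (rem_subseq _ _)) //.
    by apply/allP => z /mem_rem/dab.
  have [||||_ pos] := annihilator_sign (W := xi :: d) (g := sg) (d := rem y d)
    (kap := 1) hu hab gdy.
  - by rewrite sdy.
  - by move=> z; rewrite inE => /orP[/eqP->|/dab //]; rewrite axi.
  - by move=> j jd; apply: ann; rewrite -sdy; apply: leq_trans jd _.
  - move=> z; rewrite inE => /orP[/eqP-> _|zd].
      rewrite /sg eqxx !mul1r (_ : count _ _ = 0%N) //.
      apply/eqP; rewrite -leqn0 leqNgt -has_count; apply/hasPn => t.
      by move=> /mem_rem/din/andP[/ltW + _] /=; rewrite leNgt.
    rewrite mem_rem_uniq // !inE zd andbT negbK => /eqP->.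
    by rewrite sgd // mul1r -signr_odd godd expr1 mulrN1 oppr_ge0 ltW.
  move: pos; rewrite ann ?sdy // mulr0 ltxx => h; suff : false by []; apply: h.
  exists xi; rewrite mem_head /sg eqxx mul1r oner_neq0; split=> //.
  by apply/negP => /mem_rem; apply/negP.
(* So small a step keeps the weights on [S] nonnegative; the summand 1 avoids a division by 0. *)
have [|eps eps0 heps] := @seq_lower_bound R _ S (fun z => g z / (1 + `|be z|)).
  by move=> z zS; rewrite divr_gt0 ?gpos // ltr_pwDl.
exists eps, d, (fun z => (if z \in S then g z else 0) + eps * be z); split=> //.
  move=> z zd; split; first by have /andP[/ltW-> ->] := din z zd.
  have [zS|zS] := boolP (z \in S).
    have := heps z zS; rewrite ler_pdivlMr ?ltr_pwDl // => h.
    have h1 : 0 < eps * (1 + `|be z| + be z); last by lra.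
    by rewrite mulr_gt0 // -addrA ltr_pwDl // -lerBlDr sub0r -normrN ler_norm.
  rewrite add0r mulr_ge0 ?(ltW eps0) //.
  by case: (dP z zd) => [h|[x xt ->]]; [rewrite h in zS|rewrite bepos].
move=> j jm; under eq_bigr do rewrite mulrDl (fun_if (fun t => t * _)) mul0r.
rewrite big_split /= sum_subset //.
under [X in _ + (_ + X)]eq_bigr do rewrite -mulrA.
by rewrite -mulr_sumr hbe ?sd // -(hc _ jm); ring.
Qed.

End Improvement.

(** * Existence and continuity *)

Section Compactness.
Variable R : realType.

(** Compactness and limits are used on pairs of row vectors, as the record of rules carries no
    topology. *)
Definition rvrule N (p : 'rV[R]_N * 'rV[R]_N) : rule R N :=
  Rule (fun i => p.1 ord0 i) (fun i => p.2 ord0 i).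

Definition rule_rv N (r : rule R N) : 'rV[R]_N * 'rV[R]_N :=
  (\row_i node r i, \row_i weight r i).

Lemma rule_rvK N : cancel (@rule_rv N) (@rvrule N).
Proof. by move=> r; apply: rule_eq => i; rewrite /= mxE. Qed.

Definition box N (al be M : R) : set ('rV[R]_N * 'rV[R]_N) :=
  [set p | (forall i : 'I_N, al <= (p.1 : 'rV_N) ord0 i <= be) /\
           (forall i : 'I_N, 0 <= (p.2 : 'rV_N) ord0 i <= M)].

Lemma rvruleK N : cancel (@rvrule N) (@rule_rv N).
Proof. by case=> p q; congr (_, _); apply/rowP => i; rewrite mxE. Qed.

Lemma compact_box N al be M : compact (@box N al be M).
Proof.
have -> : @box N al be M =
    [set v : 'rV_N | forall i, `[al, be]%classic (v ord0 i)] `*`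
    [set v : 'rV_N | forall i, `[0, M]%classic (v ord0 i)].
  by apply/seteqP; split=> -[p q] [h1 h2]; split=> i /=; have /= := h1 i; have /= := h2 i;
    rewrite ?in_itv //=.
by apply: compact_setX; apply: (@rV_compact R N (fun=> _)) => i; exact: segment_compact.
Qed.

Lemma continuous_node N i : continuous (fun p : 'rV[R]_N * 'rV[R]_N => p.1 ord0 i).
Proof.
move=> p; apply: (@continuous_comp _ _ _ fst (fun v : 'rV[R]_N => v ord0 i)).
  exact: cvg_fst.
exact: coord_continuous.
Qed.

Lemma continuous_weight N i : continuous (fun p : 'rV[R]_N * 'rV[R]_N => p.2 ord0 i).
Proof.
move=> p; apply: (@continuous_comp _ _ _ snd (fun v : 'rV[R]_N => v ord0 i)).
  exact: cvg_snd.
exact: coord_continuous.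
Qed.

Lemma continuous_quad N (f : R -> R) : continuous f ->
  continuous (fun p : 'rV[R]_N * 'rV[R]_N => quad (rvrule p) f).
Proof.
move=> cf; apply: continuous_sumr => i p; apply: cvgM; first exact: continuous_weight.
apply: (@continuous_comp _ _ _ (fun p : 'rV[R]_N * 'rV[R]_N => p.1 ord0 i) f).
  exact: continuous_node.
exact: cf.
Qed.

Lemma closed_preimage_eq (T : topologicalType) (h : T -> R) (l : R) : continuous h ->
  closed [set p | h p = l].
Proof.
move=> ch; rewrite (_ : [set p | h p = l] = h @^-1` [set l]) //.
by apply: preimage_closed => //; exact: closed_eq.
Qed.

Lemma box_min N al be M (C : set ('rV[R]_N * 'rV[R]_N)) (phi : 'rV[R]_N * 'rV[R]_N -> R) :
  closed C -> continuous phi -> (@box N al be M `&` C) !=set0 ->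
  exists2 p, (@box N al be M `&` C) p &
    forall q, (@box N al be M `&` C) q -> phi p <= phi q.
Proof.
move=> cC cphi ne.
have [p pK hp] := compact_EVT_min ne (compact_closedI (@compact_box N al be M) cC)
  (continuous_subspaceT cphi).
by exists p => [|q qK]; [rewrite inE in pK|apply: hp; rewrite inE].
Qed.

(** If the filter did not converge, its restriction to the complement of some neighbourhood of [y]
    would have a cluster point in [K], which would have to be [y]. *)
Lemma unique_cluster_cvg (I : Type) (T : topologicalType) (K : set T) (F : set_system I)
  (f : I -> T) (y : T) : Filter F -> compact K -> F (f @^-1` K) ->
  (forall p, K p -> cluster (f @ F) p -> p = y) -> f @ F --> y.
Proof.
move=> FF cK FK hK O Oy; apply: contrapT => nO.
pose G := within (~` O) (f @ F).
have FG : Filter G by exact: within_filter.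
have PG : ProperFilter G.
  split=> //; apply: contra_not nO; rewrite /G /within /=.
  by apply: filterS => z h; apply: contrapT => /h.
have GK : G K by apply: filterS FK => z Kz _.
have [p [Kp cp]] := cK G PG GK.
have pE : p = y.
  by apply: hK => // A B FA; apply: cp; apply: filterS FA => z Az _.
have GO : G (~` O) by rewrite /G /within /=; exact: filterE.
by have [|z [z1 z2]] := cp _ O GO; rewrite ?pE.
Qed.

Lemma cluster_limit (I : Type) (T : topologicalType) (F : set_system I) (f : I -> T)
  (h : T -> R) (p : T) (l : R) : Filter F -> continuous h ->
  cluster (f @ F) p -> h (f x) @[x --> F] --> l -> h p = l.
Proof.
move=> FF ch cp hl; apply/esym/Rhausdorff => A B Al Bp.
have [z [z1 z2]] := cp (h @^-1` A) (h @^-1` B) (hl A Al) (ch p B Bp).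
by exists (h z).
Qed.

Lemma cluster_ge0 (I : Type) (T : topologicalType) (F : set_system I) (f : I -> T)
  (h : T -> R) (p : T) : Filter F -> continuous h ->
  cluster (f @ F) p -> F [set x | 0 <= h (f x)] -> 0 <= h p.
Proof.
move=> FF ch cp hF; rewrite leNgt; apply/negP => hp.
have [|z [/= z1 z2]] := cp [set z | 0 <= h z] (h @^-1` [set t | t < 0]) hF.
  by apply: ch; apply: open_nbhs_nbhs; split=> //; exact: open_lt.
by move: z2; rewrite ltNge z1.
Qed.

End Compactness.

Section WeightBound.
Variables (R : realType) (a b : R) (n : nat) (u : nat -> R -> R).
Hypothesis hu : complete_chebyshev_set a b n u.
Hypothesis hab : a < b.
Hypothesis n0 : (0 < n)%N.

Lemma quad_clamp N (r : rule R N) f : (forall i, a <= node r i <= b) ->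
  quad r (f \o clamp a b) = quad r f.
Proof. by move=> h; apply: eq_bigr => i _; rewrite /= clamp_id. Qed.

Lemma orient_u0 t : a <= t <= b -> 0 < orient a b u 1 * u 0%N t.
Proof.
move=> tab; have := @orient_evdet _ _ _ _ _ hu hab [:: t].
rewrite /evdet det_mx11 mxE /=; apply => //.
by rewrite /ordered_in /= tab.
Qed.

Lemma orient_u0_lower : exists2 de, 0 < de &
  forall t, a <= t <= b -> de <= orient a b u 1 * u 0%N t.
Proof.
have cf : continuous (fun t => orient a b u 1 * (u 0%N \o clamp a b) t).
  by move=> t; apply: cvgM; [exact: cvg_cst|exact: (cheb_continuous hu hab n0)].
have [t tab ht] := @EVT_min R _ _ _ (ltW hab) (continuous_subspaceT cf).
exists (orient a b u 1 * u 0%N (clamp a b t)); first by apply: orient_u0; exact: clamp_in.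
move=> s sab; have := ht s; rewrite in_itv /= => /(_ sab).
by rewrite (clamp_id sab).
Qed.

(** Since [u 0] has constant sign and is bounded away from 0, its quadrature value alone controls
    nonnegative weights, whatever the number of nodes. *)
Lemma weight_bound (c0 : R) : exists M, forall N (r : rule R N),
  (forall i, a <= node r i <= b) -> (forall i, 0 <= weight r i) ->
  `|quad r (u 0%N)| <= c0 -> forall i, weight r i < M.
Proof.
have [de de0 hde] := orient_u0_lower.
exists (`|orient a b u 1| * c0 / de + 1) => N r hin hw e0 i.
rewrite ltr_pwDr ?ltr01 // ler_pdivlMr //.
apply: le_trans (_ : orient a b u 1 * quad r (u 0%N) <= _); last first.
  by apply: le_trans (ler_norm _) _; rewrite normrM ler_wpM2l.
rewrite /quad mulr_sumr (bigD1 i) //= ler_wpDr //.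
  apply: sumr_ge0 => j _; rewrite mulrCA mulr_ge0 // (le_trans (ltW de0)) //.
  exact: hde.
by rewrite mulrCA ler_wpM2l // hde.
Qed.

End WeightBound.

(** * The family of rules with prescribed first node *)

Section Existence.
Variables (R : realType) (a b : R) (n : nat) (u : nat -> R -> R) (c : nat -> R).
Hypothesis hu : complete_chebyshev_set a b n u.
Hypothesis hab : a < b.
Variables (o : bool) (k : nat).
Hypothesis ko : (0 < k + o)%N.
Let m := (2 * k + o)%N.
Hypothesis mn : (m <= n)%N.

Let m0 : (0 < m)%N. Proof. by rewrite /m mul2n -addnn -addnA ltn_addl. Qed.
Let n0 : (0 < n)%N. Proof. exact: leq_trans m0 mn. Qed.

(** Further nodes of [r] may coincide with [xi], hence an inequality for the weight. *)
Lemma split_first_node N (r : rule R N.+1) xi : (forall i, 0 <= weight r i) ->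
  node r ord0 = xi -> (forall i, xi <= node r i) -> 0 < weight r ord0 ->
  exists S, [/\ sorted <%R S, (size S <= N)%N,
    (forall z, z \in S -> [/\ xi < z, z \in codom (node r) & 0 < mass r z]),
    weight r ord0 <= mass r xi &
    forall f, quad r f = mass r xi * f xi + \sum_(z <- S) mass r z * f z].
Proof.
move=> w0 r0 rxi pos; have [S [so sS hS rq]] := compress_rule w0.
have le : weight r ord0 <= mass r xi.
  rewrite /mass (bigD1 ord0) //= r0 eqxx mulr1n lerDl; apply: sumr_ge0 => i _.
  exact: mulrn_wge0.
have xiS : xi \in S by rewrite hS (lt_le_trans pos).
exists (rem xi S); split=> //.
- by rewrite (subseq_sorted lt_trans (rem_subseq _ _)).
- by rewrite size_rem // -subn1 leq_subLR add1n.
- move=> z; rewrite mem_rem_uniq ?(lt_sorted_uniq so) // !inE hS => /andP[zx pz].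
  have zr := mass_gt0_in pz; split=> //; rewrite lt_neqAle eq_sym zx /=.
  by case/codomP: zr => i ->.
by move=> f; rewrite rq (big_rem xi).
Qed.

Section Extremal.
Variables (th xi : R) (X : rule R k.+1).
Hypotheses (axi : a <= xi) (xith : xi < th).
Hypotheses (sX : semicanonical b u c o th X) (Xb : node X ord_max = b).
Hypothesis (X0 : ~~ o -> weight X ord_max = 0).

Let incX : increasing_nodes X. Proof. by case: sX. Qed.
Let X0th : node X ord0 = th. Proof. by case: sX. Qed.
Let posX (i : 'I_k.+1) : (i < k + o)%N -> 0 < weight X i.
Proof. by case: sX => _ _ _ h _; exact: h. Qed.
Let eX : exact_for u c m X. Proof. by case: sX. Qed.
Let inX : forall i, a <= node X i <= b.
Proof. exact: semicanonical_in (le_trans axi (ltW xith)) sX. Qed.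

Let dX := [seq node X (inord i) | i <- iota 0 (k + o)].

Let sdX : size dX = (k + o)%N. Proof. by rewrite size_map size_iota. Qed.

Let kok i : (i < k + o)%N -> (i < k.+1)%N.
Proof. by case: (o); rewrite ?addn1 ?addn0 // => /ltnW. Qed.

Let sodX : sorted <%R dX.
Proof.
apply/(sortedP 0) => i; rewrite sdX => ik.
rewrite !(nth_map 0%N) ?size_iota ?(ltnW ik) // !nth_iota ?(ltnW ik) // !add0n.
by apply: incX; rewrite !inordK // kok // ltnW.
Qed.

Let thX z : z \in dX -> th <= z.
Proof. by case/mapP => i _ ->; rewrite -X0th; exact: increasing_le. Qed.

Let ltX i : (i < k)%N -> node X (inord i) < b.
Proof. by move=> ik; rewrite -Xb; apply: incX; rewrite inordK // ltnW. Qed.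

Let quadX f : quad X f = \sum_(z <- dX) mass X z * f z.
Proof.
have uX : uniq (codom (node X)).
  by apply: lt_sorted_uniq; exact: sorted_codom.
rewrite (quad_mass f uX); last by move=> i; exact: codom_f.
rewrite -(sum_subset (d := codom (node X)) (S := dX)) //; last 2 first.
- exact: lt_sorted_uniq.
- by move=> _ /mapP[i _ ->]; exact: codom_f.
apply: eq_big_seq => _ /codomP[i ->]; case: ifPn => // nX.
have [h|h] := ltnP i (k + o).
  by case/mapP: nX; exists (i : nat); rewrite ?mem_iota // inord_val.
have ik : i = ord_max.
  by apply: val_inj => /=; have := leq_ord i; move: h; clear; lia.
have no : ~~ o by apply/negP => ho; move: h; rewrite ik ho /= addn1 ltnn.
by rewrite ik mass_node ?X0 ?mul0r //; exact: increasing_inj.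
Qed.

Let xib : xi <= b.
Proof. by have /andP[_ h] := inX ord0; rewrite ltW // (lt_le_trans xith) // -X0th. Qed.

(** There is room for [xi] and the [m] points that [increase_first_weight] returns. Nodes may
    coincide and weights may vanish, so that the set is compact. *)
Let feasible M := @box _ m.+1 xi b M `&` [set p : 'rV[R]_m.+1 * 'rV[R]_m.+1 | p.1 ord0 ord0 = xi /\
  forall j, (j < m)%N -> quad (rvrule p) (u j \o clamp a b) = c j].

Let closed_feasible : closed [set p : 'rV[R]_m.+1 * 'rV[R]_m.+1 | p.1 ord0 ord0 = xi /\
  forall j, (j < m)%N -> quad (rvrule p) (u j \o clamp a b) = c j].
Proof.
rewrite (_ : mkset _ = [set p : 'rV[R]_m.+1 * 'rV[R]_m.+1 | p.1 ord0 ord0 = xi] `&`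
  \bigcap_(j in [set j | (j < m)%N]) [set p : 'rV[R]_m.+1 * 'rV[R]_m.+1 | quad (rvrule p) (u j \o clamp a b) = c j]) //.
apply: closedI; first exact/closed_preimage_eq/continuous_node.
apply: closed_bigI => j jm; apply: closed_preimage_eq; apply: continuous_quad.
exact: (cheb_continuous hu hab (leq_trans jm mn)).
Qed.

Let pad M lam (d : seq R) (g : R -> R) :
  (forall N (r : rule R N), (forall i, a <= node r i <= b) ->
     (forall i, 0 <= weight r i) -> `|quad r (u 0%N)| <= `|c 0%N| ->
     forall i, weight r i < M) ->
  0 <= lam -> (size d <= m)%N -> (forall z, z \in d -> xi <= z <= b /\ 0 <= g z) ->
  (forall j, (j < m)%N -> lam * u j xi + \sum_(z <- d) g z * u j z = c j) ->
  exists2 p, feasible M p & p.2 ord0 ord0 = lam.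
Proof.
move=> hM lam0 dm hd hc.
pose r : rule R m.+1 := Rule (fun i => nth xi (xi :: d) i) (fun i => nth 0 (lam :: map g d) i).
have rq f : quad r f = lam * f xi + \sum_(z <- d) g z * f z.
  by rewrite /quad big_ord_recl /= sum_nth_pad.
have rin i : xi <= node r i <= b.
  rewrite /=; case: i => [[|i] ilt] /=; first by rewrite lexx.
  have [id|id] := ltnP i (size d); first by case: (hd _ (mem_nth xi id)).
  by rewrite nth_default // lexx.
have rab i : a <= node r i <= b.
  by have /andP[h1 ->] := rin i; rewrite (le_trans axi).
have rw i : 0 <= weight r i.
  rewrite /=; case: i => [[|i] ilt] //=.
  have [id|id] := ltnP i (size d); last by rewrite nth_default ?size_map.
  by rewrite (nth_map 0) //; case: (hd _ (mem_nth 0 id)).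
exists (rule_rv r); last by rewrite mxE.
split.
  split=> i; rewrite !mxE; first exact: rin.
  by rewrite rw ltW // hM // rq hc.
split=> [|j jm]; first by rewrite mxE.
by rewrite rule_rvK quad_clamp // rq hc.
Qed.

(** Maximality of the weight at [xi] ([stuck]) bounds the support from above, comparison with [X]
    ([many]) bounds it from below. The two bounds leave exactly [k] nodes besides [xi], and the
    parity of [m] decides whether [b] is one of them. *)
Lemma canonical_exists : exists r : rule R k.+1,
  [/\ semicanonical b u c o xi r, (o -> node r ord_max < b) &
     forall i, 0 < weight r i].
Proof.
have [M hM] := weight_bound hu hab n0 `|c 0%N|.
have take_lt (S : seq R) q : sorted <%R S -> (forall z, z \in S -> z <= b) ->
    (q < size S)%N -> forall z, z \in take q S -> z < b.
  move=> so hb qS z /(nthP 0)[i]; rewrite size_takel ?(ltnW qS) // => iq <-.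
  rewrite nth_take //; apply: lt_le_trans (_ : nth 0 S q <= _).
    by rewrite lt_sorted_ltn_nth // inE // (ltn_trans iq).
  exact/hb/mem_nth.
(* Some feasible rule has positive weight at [xi]: [X] has no node there, and its weight at [xi] can
   be increased from 0. *)
have [lam0 lam00 [p0 p0F p0l]] : exists2 lam, 0 < lam &
    exists2 p, feasible M p & p.2 ord0 ord0 = lam.
  have [||||||eps [d [g' [e0 sd hd hc]]]] :=
    @increase_first_weight _ a b n u hu hab m c xi 0 dX (mass X) mn axi xib sodX.
  - move=> z zX; rewrite (lt_le_trans xith) ?thX //=.
    by case/mapP: zX => i _ ->; case/andP: (inX (inord i)).
  - move=> _ /mapP[i + ->]; rewrite mem_iota add0n /= => ik.
    rewrite mass_node; last exact: increasing_inj.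
    by apply: posX; rewrite inordK // kok.
  - by move=> j jm; rewrite mul0r add0r -quadX eX.
  - by rewrite sdX /m mul2n -addnn -addnA leq_addl.
  - by rewrite sdX /m mul2n -addnn -addnA addnK leq_addr.
  - rewrite sdX /m mul2n -addnn -addnA addnK => z /(nthP 0)[i].
    rewrite size_takel ?sdX ?leq_addr // => ik <-; rewrite nth_take //.
    have iko : (i < k + o)%N by exact: leq_trans ik (leq_addr _ _).
    by rewrite (nth_map 0%N) ?size_iota // nth_iota // add0n ltX.
  rewrite add0r in hc.
  have [|p pF pl] := pad hM (ltW e0) _ hd hc; first by rewrite sd.
  by exists eps => //; exists p.
have nphi : continuous (fun p : 'rV[R]_m.+1 * 'rV[R]_m.+1 => - p.2 ord0 ord0).
  by move=> p; apply: cvgN; exact: continuous_weight.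
have [p [[pin pw] [pxi pc]] pmax] := box_min closed_feasible nphi (ex_intro _ p0 p0F).
have p_gt0 : 0 < p.2 ord0 ord0.
  by rewrite (lt_le_trans lam00) // -lerN2 -p0l; exact: pmax.
set r := rvrule p in pc.
have rab i : a <= node r i <= b.
  by have /andP[h1 ->] := pin i; rewrite (le_trans axi).
have rc j : (j < m)%N -> quad r (u j) = c j by move=> jm; rewrite -(quad_clamp _ rab) pc.
have [|//|||S [so Sm hS lamle rq]] := @split_first_node m r xi.
- by move=> i; case/andP: (pw i).
- by move=> i; case/andP: (pin i).
- exact: p_gt0.
set lam := mass r xi in lamle rq.
have lampos : 0 < lam by exact: lt_le_trans lamle.
have Sxi z : z \in S -> xi < z <= b.
  by move=> /hS[-> /codomP[i ->] _]; case/andP: (rab i).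
have hcS j : (j < m)%N -> lam * u j xi + \sum_(z <- S) mass r z * u j z = c j.
  by move=> jm; rewrite -rq rc.
(* A maximal rule admits no increase, so one of the points to be split must be [b]. *)
have stuck : (m - size S <= size S)%N ->
    exists2 z, z \in take (m - size S) S & b <= z.
  move=> qS; apply: contrapT => no.
  have [||eps [d [g' [e0 sd hd hc]]]] := @increase_first_weight _ a b n u hu hab
      m c xi lam S (mass r) mn axi xib so Sxi _ hcS Sm qS.
  - by move=> z /hS[].
  - by move=> z zt; rewrite ltNge; apply/negP => bz; apply: no; exists z.
  have [||q qF ql] := pad hM _ _ hd hc; [by rewrite addr_ge0 // ltW|by rewrite sd|].
  have := pmax q qF; rewrite ql lerN2 leNgt => /negP; apply.
  by rewrite (le_lt_trans lamle) // ltrDl.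
pose dr := xi :: S.
have sodr : sorted <%R dr.
  by rewrite /= lt_path_sortedE so andbT; apply/allP => z /Sxi/andP[].
pose rS := seqrule (size dr) dr (mass r).
have erS : exact_for u c m rS.
  by move=> j jm; rewrite quad_seqrule // big_cons hcS.
have drab z : z \in dr -> a <= z <= b.
  rewrite inE => /orP[/eqP->|/Sxi/andP[h1 ->]]; first by rewrite axi.
  by rewrite (le_trans axi) // ltW.
pose X' := seqrule (k + o) dX (mass X).
have eX' : exact_for u c m X' by move=> j jm; rewrite quad_seqrule // -quadX eX.
(* If [m] points covered both supports, the two measures would agree, but only one of them charges
   [xi]. *)
have many (L : seq R) : {subset dr <= L} -> {subset dX <= L} -> (m < size L)%N.
  move=> h1 h2; rewrite ltnNge; apply/negP => sL.
  have e1 : mass rS xi = lam.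
    by apply: mass_seqrule; rewrite ?mem_head //; exact: lt_sorted_uniq.
  have e2 : mass X' xi = 0.
    by apply/mass_notin/negP => /(codom_seqrule sdX)/thX; rewrite leNgt xith.
  have := mass_eq (r1 := rS) (r2 := X') (L := L) hu hab mn erS eX' _ _ _ _ sL xi.
  rewrite e1 e2 => h; suff e : lam = 0 by move: lampos; rewrite e ltxx.
  apply: h => [i|i|z|z].
  - exact/drab/seqrule_in.
  - have /mapP[j _ ->] := seqrule_in (mass X) i sdX; exact: inX.
  - by move=> /(codom_seqrule (erefl (size dr))); exact: h1.
  - by move=> /(codom_seqrule sdX); exact: h2.
have Sb z : z \in S -> z <= b by move=> /Sxi/andP[].
suff [sS lastS] : size S = k /\ (if o then is_true (nth 0 dr k < b) else nth 0 dr k = b).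
  have sdr : size dr = k.+1 by rewrite /= sS.
  exists (seqrule k.+1 dr (mass r)); split.
  - split=> //.
    + exact: seqrule_increasing.
    + by move: lastS; case: (o) => //= /ltW.
    + move=> i _; have := seqrule_in (mass r) i sdr.
      by rewrite /= inE => /orP[/eqP->//|/hS[]].
    + by move=> j jm; rewrite quad_seqrule // big_cons hcS.
  - by move: lastS; case: (o).
  - move=> i; have := seqrule_in (mass r) i sdr.
    by rewrite /= inE => /orP[/eqP->//|/hS[]].
have mE : m = (k + k + o)%N by rewrite /m mul2n addnn.
(* A node at [b] is shared with [X] and needs to be counted only once. *)
have [bS|bS] := boolP (b \in S).
  pose L := dr ++ [seq node X (inord i) | i <- iota 0 k].
  have sL : size L = (size S + k).+1 by rewrite size_cat size_map size_iota.
  have mL : (m < size L)%N.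
    apply: many => z zL; rewrite mem_cat ?zL //.
    case/mapP: zL => i; rewrite mem_iota /= add0n => ik ->.
    have [ik'|ik'] := ltnP i k.
      by apply/orP; right; apply/mapP; exists i; rewrite ?mem_iota.
    have -> : inord i = ord_max :> 'I_k.+1.
      by apply: val_inj; rewrite /= inordK ?kok //; apply/eqP; rewrite eqn_leq ik' -ltnS kok.
    by rewrite Xb inE bS orbT.
  rewrite sL ltnS mE in mL.
  have kS : (k + o <= size S)%N by move: mL; clear; lia.
  have qS : (m - size S <= size S)%N by rewrite mE; move: kS; clear; lia.
  have [z zt bz] := stuck qS.
  (* As the largest point of [S], [b] is among the points to be split only if all of [S] is. *)
  have le : (size S <= m - size S)%N.
    rewrite leqNgt; apply/negP => lt.
    by have := take_lt _ _ so Sb lt z zt; rewrite ltNge bz.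
  have [oE sS] : o = false /\ size S = k.
    by move: le kS; rewrite mE; clear; case: (o) => /=; lia.
  split=> //; rewrite oE.
  apply/eqP; rewrite eq_le; apply/andP; split.
    have kd : (k < size dr)%N by rewrite /= sS.
    by have /andP[] := drab _ (mem_nth 0 kd).
  have := bS; move=> /(nthP 0)[i iS <-].
  have kd : (k < size dr)%N by rewrite /= sS.
  by rewrite -[nth 0 S i]/(nth 0 dr i.+1) lt_sorted_leq_nth ?inE // -sS.
have Slt z : z \in S -> z < b.
  by move=> zS; rewrite lt_neqAle Sb // andbT; apply: contraNneq bS => <-.
(* Away from [b] nothing prevents splitting, so the support must be too small to supply the missing
   points. *)
have sk : (size S < m - size S)%N.
  rewrite ltnNge; apply/negP => qS.
  have [z /mem_take zS] := stuck qS; by rewrite leNgt Slt.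
have mL : (m < size (dr ++ dX))%N.
  by apply: many => z zL; rewrite mem_cat zL ?orbT.
rewrite size_cat sdX /= in mL.
have [oE sS] : o = true /\ size S = k.
  by move: sk mL; rewrite mE; clear; case: (o) => /=; lia.
split=> //; rewrite oE /dr -sS; case: (S) Slt => [|z S'] Slt' /=.
  by rewrite (lt_le_trans xith) // -X0th; case/andP: (inX ord0).
exact/Slt'/mem_nth.
Qed.

End Extremal.

(** A cluster point of the rules inherits only closed conditions (exactness, weak order of the
    nodes, prescribed nodes); these are what [semicanonical_eq] needs to identify it. The end [th]
    is included. *)
Lemma semicanonical_continuous th (r : R -> rule R k.+1) :
  (forall xi, a <= xi <= th ->
     semicanonical b u c o xi (r xi) /\ forall i, 0 <= weight (r xi) i) ->
  continuous_rules_on a th r.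
Proof.
move=> hr; have [M hM] := weight_bound hu hab n0 `|c 0%N|.
have rin xi : a <= xi <= th -> forall i, a <= node (r xi) i <= b.
  by move=> xiab; have /andP[axi _] := xiab; apply: semicanonical_in axi (hr _ xiab).1.
suff H x : x \in `[a, th] ->
    rule_rv (r xi) @[xi --> within `[a, th] (nbhs x)] --> rule_rv (r x).
  move=> i; split; apply/subspace_continuousP => x /H xin.
    have -> : (fun xi => node (r xi) i) =
        (fun p : 'rV[R]_k.+1 * 'rV[R]_k.+1 => p.1 ord0 i) \o (fun xi => rule_rv (r xi)).
      by apply/funext => xi; rewrite /= mxE.
    exact: (cvg_comp _ _ xin (@continuous_node _ _ i (rule_rv (r x)))).
  have -> : (fun xi => weight (r xi) i) =
      (fun p : 'rV[R]_k.+1 * 'rV[R]_k.+1 => p.2 ord0 i) \o (fun xi => rule_rv (r xi)).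
    by apply/funext => xi; rewrite /= mxE.
  exact: (cvg_comp _ _ xin (@continuous_weight _ _ i (rule_rv (r x)))).
rewrite in_itv /= => xin; have /andP[ax xth] := xin.
pose F := within `[a, th] (nbhs x).
have FF : Filter F by exact: within_filter.
have near_in (P : R -> Prop) : (forall xi, a <= xi <= th -> P xi) -> F P.
  by move=> h; apply: (@filterE _ (nbhs x)) => xi xiA; apply: h; move: xiA; rewrite /= in_itv.
apply: (@unique_cluster_cvg _ _ (@box R k.+1 a b M)).
- exact: compact_box.
- apply: near_in => xi xiab; split=> i; rewrite !mxE; first exact: rin.
  have [[_ _ _ _ e] w0] := hr xi xiab.
  rewrite w0 /= ltW //; apply: hM => //; first exact: rin.
  by rewrite e // -/m.
move=> p [pin pw] cp; rewrite -[p]rvruleK; congr rule_rv.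
have hlim (h : 'rV[R]_k.+1 * 'rV[R]_k.+1 -> R) (g : R -> R) (l : R) : continuous h ->
    (forall xi, a <= xi <= th -> h (rule_rv (r xi)) = g xi) -> g xi @[xi --> F] --> l -> h p = l.
  move=> ch hg gl; refine (@cluster_limit R _ _ F _ h p l FF ch cp _).
  by apply: cvg_trans gl; apply: near_eq_cvg; apply: near_in => xi /hg.
apply: (semicanonical_eq hu hab ko mn ax (hr x xin).1).
- move=> j jm; rewrite -(quad_clamp (r := rvrule p) _ pin).
  apply: (hlim (fun p : 'rV[R]_k.+1 * 'rV[R]_k.+1 => quad (rvrule p) (u j \o clamp a b)) (fun=> c j)).
  + exact/continuous_quad/(cheb_continuous hu hab (leq_trans jm mn)).
  + move=> xi xiab; rewrite rule_rvK quad_clamp; last exact: rin.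
    by have [[_ _ _ _ e] _] := hr xi xiab; exact: e.
  + exact: cvg_cst.
- by [].
- move=> i j ij; rewrite -subr_ge0.
  refine (@cluster_ge0 R _ _ F _
    (fun p : 'rV[R]_k.+1 * 'rV[R]_k.+1 => p.1 ord0 j - p.1 ord0 i) p FF _ cp _).
    by move=> q; apply: cvgB; exact: continuous_node.
  apply: near_in => xi xiab; rewrite /= !mxE subr_ge0.
  by have [[_ inc _ _ _] _] := hr xi xiab; exact/ltW/inc.
- apply: (hlim (fun p : 'rV[R]_k.+1 * 'rV[R]_k.+1 => p.1 ord0 ord0) id).
  + exact: continuous_node.
  + by move=> xi xiab; rewrite mxE; have [[e _ _ _ _] _] := hr xi xiab.
  + exact: cvg_within.
- move=> no; apply: (hlim (fun p : 'rV[R]_k.+1 * 'rV[R]_k.+1 => p.1 ord0 ord_max) (fun=> b)).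
  + exact: continuous_node.
  + move=> xi xiab; rewrite mxE; have [[_ _ e _ _] _] := hr xi xiab.
    by move: e; rewrite (negPf no).
  + exact: cvg_cst.
Qed.

End Existence.

(** * The sign of the residual at the ends *)

Section Step.
Variables (R : realType) (a b : R) (n : nat) (u : nat -> R -> R) (c : nat -> R).
Hypothesis hu : complete_chebyshev_set a b n u.
Hypothesis hab : a < b.
Variables (N : nat) (P : rule R N).
Hypotheses (nN : (n < N)%N) (incP : increasing_nodes P)
  (inP : forall i, a <= node P i <= b) (posP : positive_weights P)
  (eP : exact_for u c n P).

(* A rule of index [m] (interior nodes counting twice, endpoints once) is
   compared with [P] by doubling its interior nodes. *)
Lemma end_sign (m : nat) (ea eb : bool) (s : seq R) K (r : rule R K) :
  (m < n)%N -> sorted <%R s -> (forall z, z \in s -> a < z < b) ->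
  (forall z, mass r z != 0 -> z \in nseq ea a ++ s ++ nseq eb b) ->
  (ea + (2 * size s + eb))%N = m -> (forall i, a <= node r i <= b) ->
  exact_for u c m r ->
  0 < (-1) ^+ ea * osign a b u m * (c m - quad r (u m)).
Proof.
move=> mn so hs supp sm inr er.
have [e e0 gap] := seq_gap (b :: s ++ codom (node P) ++ codom (node r)).
pose d := nseq ea a ++ twin e s ++ nseq eb b.
have sd : size d = m by rewrite !size_cat !size_nseq size_twin.
have sub_d z : z \in nseq ea a ++ s ++ nseq eb b -> z \in d.
  by rewrite !mem_cat mem_twin => /or3P[->|->|->]; rewrite ?orbT.
have smid : sorted <%R (twin e s ++ nseq eb b).
  apply: sorted_twin => //.
    move=> x y xs ys; apply: gap; rewrite !inE !mem_cat ?xs ?orbT //.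
    by move: ys; rewrite mem_cat mem_nseq => /orP[->|/andP[_ ->]]; rewrite ?orbT.
  rewrite lt_sorted_pairwise pairwise_cat -!lt_sorted_pairwise so /=.
  have -> : sorted <%R (nseq eb b) by case: (eb).
  rewrite andbT; apply/allrelP => x y /hs/andP[_ xb].
  by rewrite mem_nseq => /andP[_ /eqP->].
have mid z : z \in twin e s ++ nseq eb b -> a < z <= b.
  rewrite mem_cat mem_twin mem_nseq => /orP[/orP[/hs/andP[-> /ltW->]//|zs]|/andP[_ /eqP->]]; last first.
    by rewrite hab lexx.
  have /andP[h1 h2] := hs _ zs; have := gap (z - e) b.
  rewrite !inE !mem_cat zs eqxx orbT subrK => /(_ isT isT h2)/ltW ->; rewrite andbT.
  by rewrite (lt_trans h1) // ltrBlDr ltrDl.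
have gd : ordered_in a b d.
  rewrite /ordered_in /d lt_sorted_pairwise pairwise_cat -!lt_sorted_pairwise smid.
  have -> : sorted <%R (nseq ea a) by case: (ea).
  rewrite !andbT; apply/andP; split.
    apply/allrelP => x y; rewrite mem_nseq => /andP[_ /eqP->] /mid /andP[-> //].
  apply/allP => z; rewrite mem_cat mem_nseq => /orP[/andP[_ /eqP->]|/mid/andP[/ltW h1 h2]] /=.
    by rewrite lexx ltW.
  by rewrite h1.
pose W := undup (codom (node P) ++ codom (node r)).
have uW : uniq W by exact: undup_uniq.
have WP : {subset codom (node P) <= W} by move=> z h; rewrite mem_undup mem_cat h.
have Wr : {subset codom (node r) <= W} by move=> z h; rewrite mem_undup mem_cat h orbT.
have inW z : z \in W -> a <= z <= b.
  by rewrite mem_undup mem_cat => /orP[] /codomP[i ->].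
have r0 z : z \notin d -> mass r z = 0.
  by move=> zd; apply/eqP; apply: contraNT zd => /supp; exact: sub_d.
have eP' : exact_for u c m P by move=> j jm; apply: eP; apply: ltn_trans mn.
(* Close pairs contribute an even count and [b] is never to the left of a point, so only the simple
   zero at [a] affects the sign. *)
have cnt z : z \in W -> z \notin d -> (-1) ^+ count [pred x | x < z] d = (-1) ^+ ea :> R.
  move=> zW zd; have /andP[az zb] := inW z zW.
  rewrite -signr_odd; congr (_ ^+ _); rewrite !count_cat !oddD count_twin_lt; last first.
    move=> x xs; apply/idP/idP => h; first by apply: lt_trans h; rewrite ltrDl.
    apply: gap => //; rewrite !inE !mem_cat ?xs ?orbT //.
    by move: zW; rewrite mem_undup mem_cat => ->; rewrite !orbT.
  have -> : count [pred x | x < z] (nseq eb b) = 0%N.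
    by rewrite count_nseq /= ltNge zb mul0n.
  have az' : ea -> a < z.
    move=> hea; rewrite lt_neqAle az andbT; apply: contraNneq zd => <-.
    by rewrite mem_cat mem_nseq hea eqxx.
  rewrite count_nseq !oddM /= addbF; case: (ea) az' => [/(_ isT) ->|_] //=.
  by rewrite andbF.
have [||||_ pos] := annihilator_sign (W := W) (g := fun z => mass P z - mass r z)
   (d := d) (kap := (-1) ^+ ea) hu hab gd.
- by rewrite sd.
- exact: inW.
- by rewrite sd; exact: (mass_diff uW WP Wr eP' er).
- move=> z zW zd; rewrite cnt // mulrAC -expr2 sqrr_sign mul1r r0 // subr0.
  by apply: mass_ge0 => i; exact/ltW/posP.
move: pos; rewrite sd; under eq_bigr do rewrite mulrBl.
rewrite sumrB -(quad_mass _ uW) => [|i]; last exact/WP/codom_f.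
rewrite -(quad_mass _ uW) => [|i]; last exact/Wr/codom_f.
rewrite eP //; apply.
(* Strictness: [P] has more nodes than there are zeros in [d]. *)
have [z zP zd] : exists2 z, z \in codom (node P) & z \notin d.
  apply: contrapT => h; suff : (N <= m)%N by rewrite leqNgt (ltn_trans mn nN).
  rewrite -sd -[N in (N <= _)%N]card_ord -(size_codom (node P)).
  apply: uniq_leq_size; first by apply: lt_sorted_uniq; exact: sorted_codom.
  by move=> z zP; apply: contrapT => zd; apply: h; exists z => //; apply/negP.
exists z; split=> //; first exact: WP.
rewrite r0 // subr0 mulf_neq0 ?signr_eq0 //.
case/codomP: zP => i ->; rewrite mass_node; last exact: increasing_inj.
by rewrite gt_eqF // posP.
Qed.

Variables (o : bool) (k : nat).
Hypothesis ko : (0 < k + o)%N.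
Let m := (2 * k + o)%N.
Hypothesis mn : (m < n)%N.
Variables (th : R) (X : rule R k.+1).
Hypotheses (ath : a < th) (sX : semicanonical b u c o th X)
  (Xb : node X ord_max = b) (X0 : ~~ o -> weight X ord_max = 0).

Let last_case (i : 'I_k.+1) : (i < k)%N \/ i = ord_max.
Proof.
have := ltn_ord i; rewrite ltnS leq_eqVlt => /orP[/eqP ik|->]; [right|by left].
exact/val_inj.
Qed.

Lemma sorted_slice (r : rule R k.+1) i0 q : increasing_nodes r -> (i0 + q <= k.+1)%N ->
  sorted <%R [seq node r (inord i) | i <- iota i0 q].
Proof.
move=> inc ik; apply/(sortedP 0) => i; rewrite size_map size_iota => iq.
have lt1 : (i0 + i.+1 < k.+1)%N by apply: leq_trans ik; rewrite ltn_add2l.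
have lt0 : (i0 + i < k.+1)%N by apply: ltn_trans lt1; rewrite ltn_add2l.
rewrite !(nth_map 0%N) ?size_iota ?(ltnW iq) // !nth_iota ?(ltnW iq) //.
by apply: inc; rewrite !inordK // ltn_add2l.
Qed.

(** The [k] interior nodes have index [2 * k], and [b] adds one exactly when it is known to carry
    weight. *)
Lemma last_member_sign : 0 < osign a b u m * (c m - quad X (u m)).
Proof.
have [X0th inc _ pos e] := sX.
have inX := semicanonical_in (ltW ath) sX.
have := @end_sign m false o [seq node X (inord i) | i <- iota 0 k] _ X mn.
rewrite mul1r; apply => //.
- exact: sorted_slice.
- move=> z /mapP[i]; rewrite mem_iota add0n /= => ik ->.
  have -> : node X (inord i) < b by rewrite -Xb; apply: inc; rewrite /= inordK // ltnW.
  rewrite andbT.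
  by apply: lt_le_trans ath _; rewrite -X0th; exact: increasing_le.
- move=> z; rewrite mem_cat mem_nseq; apply: contraR => nz.
  apply/eqP; have [/codomP[i zi]|] := boolP (z \in codom (node X)); last exact: mass_notin.
  move: nz; rewrite zi /=; have [ik|iE] := last_case i.
    case/negP; rewrite mem_cat; apply/orP; left; apply/mapP.
    by exists (i : nat); rewrite ?inord_val // mem_iota.
  rewrite iE Xb mem_cat mem_nseq eqxx andbT negb_or lt0b => /andP[_ no].
  by rewrite -Xb mass_node ?X0 //; exact: increasing_inj.
- by rewrite size_map size_iota.
Qed.

(** The index is again [2 * k + o]: one for [a], two for each of the [k + o - 1] interior nodes, one
    for [b] if it is prescribed. The simple zero at [a] reverses the sign. *)
Lemma first_member_sign (r : rule R k.+1) : semicanonical b u c o a r ->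
  (o -> node r ord_max < b) -> 0 < - osign a b u m * (c m - quad r (u m)).
Proof.
move=> sr rb; have [r0 inc rm pos e] := sr.
have inr := semicanonical_in (lexx a) sr.
have szE : ((k + o).-1 <= k)%N by case: (o); rewrite ?addn1 ?addn0 ?leq_pred.
have lastb (i : 'I_k.+1) : (i < k + o)%N -> node r i < b.
  move: rb rm; case: (o) => [rb _ _|_ rm].
    by apply: le_lt_trans (rb isT); apply: increasing_le => //; exact: leq_ord.
  by rewrite addn0 => ik; rewrite -rm; exact: inc.
have := @end_sign m true (~~ o) [seq node r (inord i) | i <- iota 1 (k + o).-1] _ r mn.
rewrite expr1 mulN1r; apply => //.
- by apply: sorted_slice => //; rewrite add1n ltnS.
- move=> z /mapP[i]; rewrite mem_iota add1n prednK // => /andP[i0 ik] ->.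
  have ik1 : (i < k.+1)%N by apply: leq_trans ik _; case: (o); rewrite ?addn1 ?addn0 // ltnW.
  by rewrite -{1}r0 inc ?lastb ?inordK.
- move=> z; rewrite mem_cat mem_nseq /=; apply: contraR => nz.
  apply/eqP; have [/codomP[i zi]|] := boolP (z \in codom (node r)); last exact: mass_notin.
  move: nz; rewrite zi; have [i0|i0] := posnP i.
    by rewrite (_ : i = ord0) ?r0 ?eqxx //; exact: val_inj.
  have [ik|ik] := ltnP i (k + o).
    case/negP; apply/orP; right; rewrite mem_cat; apply/orP; left.
    apply/mapP; exists (i : nat); rewrite ?inord_val //.
    by rewrite mem_iota i0 add1n prednK.
  have no : ~~ o.
    by apply/negP => ho; have := leq_trans ik (leq_ord i); rewrite ho addn1 ltnn.
  have iE : i = ord_max.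
    by case: (last_case i) => // ik'; move: ik; rewrite leqNgt ltn_addr.
  by rewrite mem_cat mem_nseq iE; move: rm; rewrite no (negPf no) => ->; rewrite eqxx !orbT.
- rewrite size_map size_iota /m; move: ko; clear; case: (o) => /=; lia.
Qed.

(* One pass of the algorithm: [o = false] is step (2a), [o = true] is step
   (2b), and [o = true], [k = 0] is step (1). *)
Lemma root_finding_step : exists r : R -> rule R k.+1,
  [/\ forall xi, a <= xi < th -> [/\ semicanonical b u c o xi (r xi),
         (o -> node (r xi) ord_max < b) & positive_weights (r xi)],
      r th = X, continuous_rules_on a th r &
      forall i : 'I_k.+1, (i < k + o)%N ->
        strictly_increasing_on a th (fun xi => node (r xi) i)] /\
  let F := fun xi => quad (r xi) (u m) - c m in
  strictly_monotonic_on a th F /\ exists2 z, a < z < th & F z = 0.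
Proof.
(* The rule at [th] is imposed, since existence is known only to the left of it; outside the
   interval [X] is a default value. *)
have /choice[r hr] : forall xi, exists r : rule R k.+1,
    (a <= xi < th -> [/\ semicanonical b u c o xi r,
       (o -> node r ord_max < b) & positive_weights r]) /\ (xi = th -> r = X).
  move=> xi; have [lt|ge] := ltP xi th; last first.
    by exists X; split=> //; rewrite andbF.
  have [axi|axi] := leP a xi; last by exists X; split=> //; rewrite (lt_eqF lt).
  have [r [h1 h2 h3]] := canonical_exists hu hab ko (ltnW mn) axi lt sX Xb X0.
  by exists r; split=> // e; move: lt; rewrite e ltxx.
have rX : r th = X by exact: (hr th).2.
have hsemi xi : a <= xi <= th ->
    semicanonical b u c o xi (r xi) /\ forall i, 0 <= weight (r xi) i.
  move=> /andP[axi]; rewrite le_eqVlt => /orP[/eqP->|lt].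
    rewrite rX; split=> // i; have [_ _ _ pos _] := sX.
    have [h|h] := ltnP i (k + o); first exact/ltW/pos.
    have no : ~~ o.
      by apply/negP => ho; have := leq_trans h (leq_ord i); rewrite ho addn1 ltnn.
    have [ik|->] := last_case i; last by rewrite X0.
    by move: h; rewrite leqNgt ltn_addr.
  have [|h1 _ h3] := (hr xi).1; first by rewrite axi.
  by split=> // i; exact/ltW/h3.
have cr : continuous_rules_on a th r by exact: (semicanonical_continuous hu hab ko (ltnW mn) hsemi).
exists r; split.
  split=> //; first by move=> xi /(hr xi).1.
  move=> i ik xi xi'; rewrite !in_itv /= => h1 h2 lt.
  have /andP[axi _] := h1.
  exact: (semicanonical_node_lt hu hab ko (ltnW mn) axi lt (hsemi _ h1).1 (hsemi _ h2).1).
move=> F.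
have Flt xi xi' : a <= xi <= th -> a <= xi' <= th -> xi < xi' ->
    0 < osign a b u m * (F xi - F xi').
  move=> h1 h2 lt; have /andP[axi _] := h1.
  rewrite /F opprB addrA subrK.
  exact: (semicanonical_quad_lt hu hab ko (ltnW mn) axi lt (hsemi _ h1).1 (hsemi _ h2).1).
have tha : a <= th <= th by rewrite lexx ltW.
have aa : a <= a <= th by rewrite lexx ltW.
split.
  have [os|os] := ltP 0 (osign a b u m); [right|left] => xi xi'; rewrite !in_itv /= => h1 h2 lt.
    by have := Flt _ _ h2 h1 lt; rewrite pmulr_rgt0 // subr_gt0.
  have := Flt _ _ h1 h2 lt; rewrite -mulrNN pmulr_rgt0 ?oppr_gt0 ?subr_lt0 //.
  rewrite lt_neqAle os andbT; apply: contraTneq (Flt _ _ aa tha ath) => ->.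
  by rewrite mul0r ltxx.
have cF : {within `[a, th], continuous F}.
  (* Clamping changes nothing at the nodes and makes [u m] continuous everywhere. *)
  apply: (@subspace_eq_continuous _ _ _ (fun xi => \sum_(i < k.+1) weight (r xi) i *
      (u m \o clamp a b) (node (r xi) i) - c m)).
    move=> xi; rewrite inE /= in_itv /= => xiab; congr (_ - _).
    apply: eq_bigr => i _; rewrite /= clamp_id //.
    by have /andP[axi _] := xiab; apply: semicanonical_in axi (hsemi _ xiab).1 _.
  move=> xi; apply: cvgB; last exact: cvg_cst.
  have : continuous (fun xi : subspace `[a, th] => \sum_(i < k.+1) weight (r xi) i *
      (u m \o clamp a b) (node (r xi) i)); last exact.
  apply: continuous_sumr => i z; have [c1 c2] := cr i; apply: cvgM; first exact: c2.
  apply: (@continuous_comp _ _ _ (fun xi : subspace `[a, th] => node (r xi) i)).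
    exact: c1.
  exact: (cheb_continuous hu hab mn).
have Fth : 0 < - osign a b u m * F th.
  by rewrite mulNr -mulrN /F rX opprB; exact: last_member_sign.
have Fa : 0 < osign a b u m * F a.
  have [h1 h2 _] := (hr a).1 (introT andP (conj (lexx a) ath)).
  by rewrite -mulrNN /F opprB; exact: first_member_sign.
have sgn : F a < 0 < F th \/ F th < 0 < F a.
  have [os|os] := ltP 0 (osign a b u m); [right|left].
    move: Fth Fa; rewrite mulNr -mulrN !(pmulr_rgt0 _ os) oppr_gt0.
    by move=> -> ->.
  have os' : 0 < - osign a b u m.
    rewrite oppr_gt0 lt_neqAle os andbT.
    by apply: contraTneq Fa => ->; rewrite mul0r ltxx.
  move: Fth Fa; rewrite -[X in _ -> 0 < X -> _]mulrNN !(pmulr_rgt0 _ os') oppr_gt0.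
  by move=> -> ->.
have [|z] := @IVT R F a th 0 (ltW ath) cF.
  by rewrite ge_min le_max; case: sgn => /andP[/ltW-> /ltW->]; rewrite ?orbT.
rewrite in_itv /= => /andP[az zth] Fz; exists z => //.
rewrite !lt_neqAle az zth !andbT; apply/andP; split; apply: contraPneq sgn => e.
  by rewrite e Fz ltxx andbF; case.
by rewrite -e Fz ltxx andbF; case.
Qed.

End Step.

(** * Discretization of the integral *)

Section ConeRule.
Variables (R : realType) (a b : R) (n' : nat) (u : nat -> R -> R).
Let n := n'.+1.
Hypothesis hu : complete_chebyshev_set a b n u.
Hypothesis hab : a < b.

Variables (al be : R) (v : nat -> R).
Hypotheses (aal : a <= al) (albe : al <= be) (beb : be <= b).
Hypothesis hv : forall p : nat -> R,
  (forall t, al <= t <= be -> 0 <= \sum_(j < n) p j * u j t) ->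
  0 <= \sum_(j < n) p j * v j.

Let res N (r : rule R N) j := v j - quad r (u j).
Let dist N (r : rule R N) := \sum_(j < n) res r j ^+ 2.
Let admissible N (r : rule R N) :=
  (forall i, al <= node r i <= be) /\ (forall i, 0 <= weight r i).

Let inab t : al <= t <= be -> a <= t <= b.
Proof. by case/andP=> /(le_trans aal) -> /le_trans; apply. Qed.

(** The projection of [v] onto the rules with [n] nodes in [[al, be]], with its first-order
    condition: the squared distance does not decrease along an admissible direction [h]. *)
Let nearest : exists r : rule R n, admissible r /\
  forall (h : nat -> R) e0, 0 < e0 ->
    (forall e, 0 < e -> e <= e0 -> exists2 r' : rule R n, admissible r' &
       forall j, (j < n)%N -> quad r' (u j) = quad r (u j) + e * h j) ->
    \sum_(j < n) res r j * h j <= 0.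
Proof.
pose B := \sum_(j < n) v j ^+ 2.
have B0 : 0 <= B by apply: sumr_ge0 => j _; exact: sqr_ge0.
(* The bound leaves slack: [B] is the squared distance of the zero rule, so the minimizer has value
   at most [|v 0| + (1 + B) / 2] on [u 0], and small variations of it stay in the box. *)
have [M hM] := weight_bound hu hab (ltn0Sn n') (`|v 0%N| + 1 + B).
pose uc j := u j \o clamp a b.
pose phi (p : 'rV[R]_n * 'rV[R]_n) := \sum_(j < n) (v j - quad (rvrule p) (uc j)) ^+ 2.
have cphi : continuous phi.
  apply: continuous_sumr => j p.
  have cd : continuous (fun p : 'rV[R]_n * 'rV[R]_n => v j - quad (rvrule p) (uc j)).
    move=> q; apply: cvgB; first exact: cvg_cst.
    by apply: continuous_quad; exact: (cheb_continuous hu hab).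
  by apply: (@cvg_comp _ _ _ _ (fun x : R => x ^+ 2) _ _ _ (cd p)); exact: exprn_continuous.
have phiE (r : rule R n) : admissible r -> phi (rule_rv r) = dist r.
  move=> [hr _]; apply: eq_bigr => j _; congr (_ ^+ 2).
  by rewrite rule_rvK quad_clamp // => i; apply: inab.
have inbox (r : rule R n) : admissible r -> `|quad r (u 0%N)| <= `|v 0%N| + 1 + B ->
    box al be M (rule_rv r).
  move=> [h1 h2] h3; split=> i; rewrite !mxE; first exact: h1.
  by rewrite h2 ltW // hM // => j; exact: inab.
pose r0 : rule R n := Rule (fun=> al) (fun=> 0).
have quad0 f : quad r0 f = 0 by apply: big1 => i _; rewrite mul0r.
have adm0 : admissible r0 by split=> i /=; rewrite lexx.
have box0 : box al be M (rule_rv r0).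
  by apply: inbox => //; rewrite quad0 normr0 -addrA addr_ge0 // addr_ge0.
have [|p [[pin pw] _] pmin] := @box_min R n al be M setT phi closedT cphi.
  by exists (rule_rv r0).
pose r := rvrule p.
have admr : admissible r.
  by split=> [//|i]; case/andP: (pw i).
have rmin (r' : rule R n) : admissible r' -> `|quad r' (u 0%N)| <= `|v 0%N| + 1 + B ->
    dist r <= dist r'.
  move=> h1 h2; rewrite -!phiE // rvruleK; apply: pmin; split=> //; exact: inbox.
have distB : dist r <= B.
  apply: le_trans (rmin r0 adm0 _) _; first by rewrite quad0 normr0 -addrA addr_ge0 // addr_ge0.
  by rewrite /dist /res; under eq_bigr do rewrite quad0 subr0.
have q0 : `|quad r (u 0%N)| <= `|v 0%N| + (1 + B) / 2.
  have h1 : (v 0%N - quad r (u 0%N)) ^+ 2 <= B.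
    apply: le_trans distB; rewrite /dist big_ord_recl lerDl.
    by apply: sumr_ge0 => j _; exact: sqr_ge0.
  (* From [x ^+ 2 <= B] by [2 * x <= 1 + x ^+ 2]. *)
  have h2 : `|v 0%N - quad r (u 0%N)| <= (1 + B) / 2.
    rewrite -real_normK ?num_real // in h1; set x := `|_| in h1 *.
    by have := sqr_ge0 (x - 1); rewrite sqrrB1; lra.
  rewrite (_ : quad r (u 0%N) = v 0%N - (v 0%N - quad r (u 0%N))); last by ring.
  by apply: le_trans (ler_normB _ _) _; rewrite lerD2l.
exists r; split=> // h e0 e00 hdir.
set A := \sum_(j < n) _; rewrite leNgt; apply/negP => A0.
pose H := \sum_(j < n) h j ^+ 2.
have H0 : 0 <= H by apply: sumr_ge0 => j _; exact: sqr_ge0.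
(* The three bounds keep the variation admissible, keep it in the box, and make the quadratic term
   smaller than the linear gain [2 * e * A]. *)
pose e := Num.min e0 (Num.min (2 * (`|h 0%N| + 1))^-1 (A / (H + 1))).
have hh : 0 < `|h 0%N| + 1 by rewrite ltr_wpDl.
have H1 : 0 < H + 1 by rewrite ltr_wpDl.
have e_gt0 : 0 < e.
  by rewrite !lt_min e00 invr_gt0 mulr_gt0 //= divr_gt0.
have e_le0 : e <= e0 by rewrite ge_min lexx.
have e_le1 : e * `|h 0%N| <= 1 / 2.
  have : e <= (2 * (`|h 0%N| + 1))^-1 by rewrite !ge_min lexx orbT.
  rewrite invfM => h1.
  have : e * (`|h 0%N| + 1) <= 1 / 2.
    by rewrite -ler_pdivlMr // mul1r mulrC // mulrC.
  by lra.
have e_le2 : e * (H + 1) <= A.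
  have : e <= A / (H + 1) by rewrite !ge_min lexx !orbT.
  by rewrite ler_pdivlMr.
have [r' admr' hr'] := hdir e e_gt0 e_le0.
have : dist r <= dist r'.
  apply: rmin => //; rewrite hr' //; apply: le_trans (ler_normD _ _) _.
  rewrite normrM (gtr0_norm e_gt0).
  by apply: le_trans (lerD q0 e_le1) _; lra.
have -> : dist r' = dist r - 2 * e * A + e ^+ 2 * H.
  rewrite /dist /A /H !mulr_sumr -sumrB -big_split /=; apply: eq_bigr => j _.
  by rewrite /res hr' //; ring.
have : e * (e * H) < e * (2 * A).
  rewrite ltr_pM2l //; lra.
by lra.
Qed.

(** Bipolar argument: [hv] says that [v] is nonnegative on the dual cone. The residual of the
    nearest rule has nonpositive product with every point evaluation, hence with [v] by [hv], and
    nonnegative product with the rule itself, so its square is not positive. *)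
Lemma cone_rule : exists S g, [/\ sorted <%R S,
  (forall z, z \in S -> al <= z <= be /\ 0 < g z) &
  forall j, (j < n)%N -> \sum_(z <- S) g z * u j z = v j].
Proof.
have [r [[rin rw] hdir]] := nearest.
have [S [so Sn hS rq]] := compress_rule rw.
exists S, (mass r).
have Sin z : z \in S -> al <= z <= be /\ 0 < mass r z.
  by rewrite hS => h; split=> //; have /codomP[i ->] := mass_gt0_in h.
split=> //.
suff H : \sum_(j < n) res r j ^+ 2 <= 0.
  move=> j jn; rewrite -rq; apply/esym/eqP; rewrite -subr_eq0 -sqrf_eq0.
  have : \sum_(j < n) res r j ^+ 2 == 0.
    by rewrite eq_le H sumr_ge0 // => i _; exact: sqr_ge0.
  rewrite psumr_eq0; last by move=> i _; exact: sqr_ge0.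
  by move=> /allP/(_ (Ordinal jn)); rewrite mem_index_enum; exact.
under eq_bigr do rewrite expr2.
(* A support of [n] points leaves no room for another node, but its collocation matrix is
   invertible, so the residual itself is an admissible direction. *)
move: Sn; rewrite leq_eqVlt => /orP[/eqP sS|Sn].
  have gS : ordered_in a b S.
    by rewrite /ordered_in so; apply/allP => z /Sin[/inab].
  have [|g hg] := evdet_solve hu (d := S) (res r) gS; first by rewrite sS.
  have [|e0 e00 he] := @seq_lower_bound R _ S (fun z => mass r z / (1 + `|g z|)).
    by move=> z /Sin[_ h]; rewrite divr_gt0 // ltr_pwDl.
  apply: (hdir _ e0) => // e ep ee.
  exists (seqrule n S (fun z => mass r z + e * g z)).
    split=> i; have zS := seqrule_in (fun z => mass r z + e * g z) i sS.
      by have [] := Sin _ zS.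
    move: zS; rewrite /=; set z := nth _ _ _ => zS.
    have [_ gz] := Sin z zS.
    have h1 : e * `|g z| <= mass r z.
      have := le_trans ee (he z zS); rewrite ler_pdivlMr ?ltr_pwDl //.
      by rewrite mulrDr mulr1; apply: le_trans; rewrite lerDr ltW.
    by have := ler_norm (- (e * g z)); rewrite normrN normrM (gtr0_norm ep); lra.
  move=> j jn; rewrite quad_seqrule //; under eq_bigr do rewrite mulrDl -mulrA.
  by rewrite big_split /= -mulr_sumr hg ?sS // -rq.
have padq e (g : R -> R) t : quad (Rule (fun i : 'I_n => nth al (t :: S) i)
     (fun i => nth 0 (e :: map g S) i)) =1
   (fun f => e * f t + \sum_(z <- S) g z * f z).
  by move=> f; rewrite /quad big_ord_recl /= sum_nth_pad.
have padadm e (g : R -> R) t : 0 <= e -> al <= t <= be -> (forall z, z \in S -> 0 <= g z) ->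
   admissible (Rule (fun i : 'I_n => nth al (t :: S) i)
     (fun i => nth 0 (e :: map g S) i)).
  move=> e0 tin g0; split=> -[[|i] ilt] //=; have [iS|iS] := ltnP i (size S).
  - by case: (Sin _ (mem_nth al iS)).
  - by rewrite nth_default // lexx.
  - by rewrite (nth_map 0) //; apply: g0; exact: mem_nth.
  - by rewrite nth_default ?size_map.
have alin : al <= al <= be by rewrite lexx.
have dir1 t : al <= t <= be -> \sum_(j < n) res r j * u j t <= 0.
  move=> tin; apply: (hdir (fun j => u j t) 1) => // e e0 _.
  eexists; first by apply: (padadm e (mass r) t (ltW e0) tin) => z /Sin[_ /ltW].
  by move=> j jn; rewrite padq rq addrC.
have dir2 : \sum_(j < n) res r j * - quad r (u j) <= 0.
  apply: (hdir (fun j => - quad r (u j)) 1) => // e e0 e1.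
  eexists; first by apply: (padadm 0 (fun z => (1 - e) * mass r z) al) => // z /Sin[_ /ltW h];
    rewrite mulr_ge0 // subr_ge0.
  move=> j jn; rewrite padq mul0r add0r; under eq_bigr do rewrite -mulrA.
  by rewrite -mulr_sumr rq; ring.
(* By [dir1], the coefficients [- res r j] give a combination that is nonnegative on [[al, be]]. *)
have := hv (p := fun j => - res r j); under [X in _ -> 0 <= X]eq_bigr do rewrite mulNr.
rewrite sumrN oppr_ge0 => h.
have h3 : \sum_(j < n) res r j * v j <= 0.
  apply: h => t /dir1; under [X in _ -> 0 <= X]eq_bigr do rewrite mulNr.
  by rewrite sumrN oppr_ge0.
have := lerD h3 dir2; rewrite addr0 -big_split /=.
by under eq_bigr do rewrite -mulrDr.
Qed.

End ConeRule.

(** * Rules with many nodes for the integral *)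

Section Discretization.
Variables (R : realType) (a b : R) (n' : nat) (u : nat -> R -> R) (w : R -> R).
Let n := n'.+1.
Hypothesis hu : complete_chebyshev_set a b n u.
Hypothesis hab : a < b.
Hypothesis hw : forall t, a <= t <= b -> 0 < w t.
Hypothesis hwi : (@lebesgue_measure R).-integrable `[a, b] (EFin \o w).

Let sub al be : a <= al -> be <= b -> `[al, be]%classic `<=` `[a, b].
Proof.
move=> aal beb t; rewrite /= !in_itv /= => /andP[h1 h2].
by rewrite (le_trans aal) // (le_trans h2).
Qed.

Lemma integrable_moment al be j : a <= al -> be <= b -> (j < n)%N ->
  (@lebesgue_measure R).-integrable `[al, be] (EFin \o (fun t => u j t * w t)).
Proof.
move=> aal beb jn.
suff H : (@lebesgue_measure R).-integrable `[a, b] (EFin \o (fun t => u j t * w t)).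
  by apply: integrableS H => //; exact: sub.
have cu := cheb_continuous hu hab jn.
have h : (@lebesgue_measure R).-integrable `[a, b]
    ((EFin \o w) \* (EFin \o (u j \o clamp a b)))%E.
  apply: integrableMl => //.
    by apply: measurable_realfun.subspace_continuous_measurable_fun => //; exact: continuous_subspaceT.
  have [t tab ht] := @EVT_max R (fun t => `|(u j \o clamp a b) t|) _ _ (ltW hab)
    (continuous_subspaceT (fun t => continuous_comp (cu t) (@norm_continuous _ _ _))).
  rewrite /bounded_near; near=> M; move=> s sab; change (`|(u j \o clamp a b) s| <= M).
  apply: (le_trans (ht s sab)).
  by near: M; exact: nbhs_pinfty_ge.
apply: eq_integrable h => // t; rewrite inE /= in_itv /= => tab.
by rewrite clamp_id // mulrC.
Unshelve. all: by end_near.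
Qed.

Lemma moment_split al ga be j : a <= al -> al <= ga -> ga <= be -> be <= b -> (j < n)%N ->
  moment al be u w j = moment al ga u w j + moment ga be u w j.
Proof.
move=> aal alga gabe beb jn.
rewrite {1}/moment.
have := @Rintegral_itvB R (fun t => u j t * w t) (BLeft al) (BRight be) ga.
rewrite !bnd_simp => /(_ (integrable_moment aal beb jn) alga gabe) /eqP.
rewrite subr_eq => /eqP ->; rewrite addrC; congr (_ + _).
rewrite Rintegral_itv_obnd_cbnd //.
apply: integrableS (integrable_moment aal beb jn) => //.
move=> t; rewrite /= !in_itv /= => /andP[h1 ->]; rewrite andbT.
exact: le_trans alga (ltW h1).
Qed.

Lemma moment_sum al be (p : nat -> R) : a <= al -> be <= b ->
  \sum_(j < n) p j * moment al be u w j =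
  \int[@lebesgue_measure R]_(t in `[al, be]) ((\sum_(j < n) p j * u j t) * w t).
Proof.
move=> aal beb.
have H q : (q <= n)%N ->
    (@lebesgue_measure R).-integrable `[al, be] (EFin \o (fun t => (\sum_(j < q) p j * u j t) * w t)) /\
    \sum_(j < q) p j * moment al be u w j =
    \int[@lebesgue_measure R]_(t in `[al, be]) ((\sum_(j < q) p j * u j t) * w t).
  elim: q => [_|q IH qn].
    rewrite big_ord0; have e : (fun t => (\sum_(j < 0) p j * u j t) * w t) = cst 0.
      by apply/funext => t; rewrite big_ord0 mul0r.
    rewrite e; split; first exact: integrable0.
    by rewrite Rintegral_cst // mul0r.
  have [i1 e1] := IH (ltnW qn).
  have iq := integrable_moment aal beb qn.
  have iq' : (@lebesgue_measure R).-integrable `[al, be]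
      (EFin \o (fun t => p q * (u q t * w t))).
    by apply: (eq_integrable _ _ _ _ (integrableZl _ (p q) iq)).
  have e : (fun t => (\sum_(j < q.+1) p j * u j t) * w t) =
     (fun t => (\sum_(j < q) p j * u j t) * w t + p q * (u q t * w t)).
    by apply/funext => t; rewrite big_ord_recr /= mulrDl mulrA.
  rewrite e; split.
    by apply: (eq_integrable _ _ _ _ (integrableD _ i1 iq')).
  by rewrite RintegralD // RintegralZl // -e1 big_ord_recr.
exact: (H n (leqnn n)).2.
Qed.

Lemma moment_nonneg al be (p : nat -> R) : a <= al -> be <= b ->
  (forall t, al <= t <= be -> 0 <= \sum_(j < n) p j * u j t) ->
  0 <= \sum_(j < n) p j * moment al be u w j.
Proof.
move=> aal beb hp; rewrite moment_sum //; apply: Rintegral_ge0 => t tin.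
have := sub aal beb tin; move: tin; rewrite /= !in_itv /= => tin tab.
by rewrite mulr_ge0 ?hp // ltW // hw.
Qed.

(** The integrand has a strict constant sign, so a vanishing integral would make the interval a null
    set. Hence every exact rule on a nondegenerate subinterval has a node. *)
Lemma moment0_neq0 al be : a <= al -> al < be -> be <= b ->
  moment al be u w 0%N != 0.
Proof.
move=> aal albe beb; apply/eqP => m0.
pose f t := orient a b u 1 * u 0%N t * w t.
have fpos t : t \in `[al, be] -> 0 < f t.
  move=> tin; have := sub aal beb tin; rewrite /= in_itv /= => tab.
  by rewrite mulr_gt0 ?hw // (orient_u0 hu).
have fi : (@lebesgue_measure R).-integrable `[al, be] (EFin \o f).
  have i0 := integrable_moment aal beb (ltn0Sn n').
  apply: (eq_integrable _ _ _ _ (integrableZl _ (orient a b u 1) i0)) => //.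
  by move=> t _; rewrite /= -EFinM /f mulrA.
have f0 : \int[@lebesgue_measure R]_(t in `[al, be]) f t = 0.
  have i0 := integrable_moment aal beb (ltn0Sn n').
  rewrite -(mulr0 (orient a b u 1)) -m0 /moment -RintegralZl //.
  by apply: eq_Rintegral => t _; rewrite /f mulrA.
have If : (\int[@lebesgue_measure R]_(t in `[al, be]) (f t)%:E = 0)%E.
  have fin : (\int[@lebesgue_measure R]_(t in `[al, be]) (f t)%:E)%E \is a fin_num.
    exact: integrable_fin_num fi.
  by rewrite -(fineK fin); congr (_%:E); exact: f0.
have Iabs : (\int[@lebesgue_measure R]_(t in `[al, be]) `|(EFin \o f) t| = 0)%E.
  rewrite -If; apply: eq_integral => t; rewrite inE => /fpos/ltW tf.
  by rewrite gee0_abs // lee_fin.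
have neg : ae_eq (@lebesgue_measure R) `[al, be]%classic (EFin \o f) (cst 0%E).
  by apply/ae_eq_integral_abs => //; exact: measurable_int fi.
have : (@lebesgue_measure R) `[al, be]%classic = 0%E.
  apply: measure_negligible => //; apply: negligibleS neg => t /= tin /(_ tin) [ft].
  by have := fpos t tin; rewrite ft ltxx.
rewrite lebesgue_measure_itv /= lte_fin albe -EFinB => -[] /eqP.
by rewrite subr_eq0 gt_eqF.
Qed.

Lemma rule_on_interval al be : a <= al -> al <= be -> be <= b ->
  exists S g, [/\ uniq S, (forall z, z \in S -> al <= z <= be /\ 0 < g z) &
  forall j, (j < n)%N -> \sum_(z <- S) g z * u j z = moment al be u w j].
Proof.
move=> aal albe beb.
have [|S [g [so h1 h2]]] := @cone_rule _ a b n' u hu hab al be (moment al be u w) aal albe beb.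
  by move=> p; exact: moment_nonneg.
by exists S, g; split=> //; exact: lt_sorted_uniq.
Qed.

Lemma merge_rules (S1 S2 : seq R) (g1 g2 : R -> R) : uniq S1 -> uniq S2 ->
  (forall z, z \in S1 -> 0 < g1 z) -> (forall z, z \in S2 -> 0 < g2 z) ->
  exists S g, [/\ uniq S, (forall z, (z \in S) = (z \in S1) || (z \in S2)),
   (forall z, z \in S -> 0 < g z) &
   forall f : R -> R, \sum_(z <- S) g z * f z =
     \sum_(z <- S1) g1 z * f z + \sum_(z <- S2) g2 z * f z].
Proof.
move=> u1 u2 p1 p2; exists (undup (S1 ++ S2)).
exists (fun z => (if z \in S1 then g1 z else 0) + (if z \in S2 then g2 z else 0)).
have mem z : (z \in undup (S1 ++ S2)) = (z \in S1) || (z \in S2).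
  by rewrite mem_undup mem_cat.
split=> [||z|f]; rewrite ?undup_uniq //.
  rewrite mem; case: (boolP (z \in S1)) => [/p1 h1|_]; case: (boolP (z \in S2)) => [/p2 h2|_] //.
  - by rewrite addr_gt0.
  - by rewrite addr0.
  - by rewrite add0r.
under eq_bigr do rewrite mulrDl !(fun_if (fun t => t * _)) !mul0r.
rewrite big_split /=; congr (_ + _); apply: sum_subset; rewrite ?undup_uniq //.
  by move=> z zS; rewrite mem zS.
by move=> z zS; rewrite mem zS orbT.
Qed.

(** The left third supplies [q] nodes and the right third at least one more; the middle third
    separates them, so that they cannot coincide. *)
Lemma rule_many_nodes q al be : a <= al -> al < be -> be <= b ->
  exists S g, [/\ uniq S, (q <= size S)%N,
    (forall z, z \in S -> al <= z <= be /\ 0 < g z) &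
  forall j, (j < n)%N -> \sum_(z <- S) g z * u j z = moment al be u w j].
Proof.
elim: q al be => [|q IH] al be aal albe beb.
  by have [S [g [h1 h2 h3]]] := rule_on_interval aal (ltW albe) beb; exists S, g.
pose g1 := (2 * al + be) / 3; pose g2 := (al + 2 * be) / 3.
have h1 : al < g1 by rewrite /g1; lra.
have h2 : g1 < g2 by rewrite /g1 /g2; lra.
have h3 : g2 < be by rewrite /g2; lra.
have ag1 : a <= g1 by rewrite (le_trans aal) // ltW.
have ag2 : a <= g2 by rewrite (le_trans ag1) // ltW.
have g2b : g2 <= b by rewrite (le_trans (ltW h3)).
have g1b : g1 <= b by rewrite (le_trans (ltW h2)).
have [S1 [w1 [u1 s1 in1 e1]]] := IH al g1 aal h1 g1b.
have [S2 [w2 [u2 in2 e2]]] := rule_on_interval ag1 (ltW h2) g2b.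
have [S3 [w3 [u3 in3 e3]]] := rule_on_interval ag2 (ltW h3) beb.
have [S4 [w4 [u4 m4 p4 e4]]] := merge_rules u1 u2 (fun z zS => (in1 z zS).2) (fun z zS => (in2 z zS).2).
have [S [w5 [u5 m5 p5 e5]]] := merge_rules u4 u3 p4 (fun z zS => (in3 z zS).2).
exists S, w5; split=> //.
- have S30 : (0 < size S3)%N.
    rewrite lt0n; apply: contra_neq (moment0_neq0 ag2 h3 beb) => /size0nil s3.
    by rewrite -(e3 0%N) // s3 big_nil.
  apply: leq_trans (_ : size (S1 ++ S3) <= _)%N.
    by rewrite size_cat -addn1 leq_add.
  apply: uniq_leq_size.
    rewrite cat_uniq u1 u3 andbT; apply/hasPn => z /in3[/andP[z1 _] _].
    apply/negP => /in1[/andP[_ z2] _].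
    by have := le_lt_trans (le_trans z1 z2) h2; rewrite ltxx.
  by move=> z; rewrite mem_cat m5 m4 => /orP[->|->]; rewrite ?orbT.
- move=> z zS; split; last exact: p5.
  move: zS; rewrite m5 m4 => /orP[/orP[/in1|/in2]|/in3] [/andP[z1 z2] _]; apply/andP; split.
  + by [].
  + by rewrite (le_trans z2) // ltW // (lt_trans h2).
  + by rewrite (le_trans (ltW h1)).
  + by rewrite (le_trans z2) // ltW.
  + by rewrite (le_trans _ z1) // ltW // (lt_trans h1).
  + by [].
move=> j jn; rewrite e5 e4 e1 // e2 // e3 // -moment_split ?(ltW h1) ?(ltW h2) //.
by rewrite -moment_split ?(ltW h3) // ltW // (lt_trans h1).
Qed.

Lemma exact_rule_many_nodes : exists N (P : rule R N),
  [/\ (n < N)%N, increasing_nodes P, (forall i, a <= node P i <= b),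
    positive_weights P & exact_for u (moment a b u w) n P].
Proof.
have [S [g [uS sS hS eS]]] := rule_many_nodes n.+1 (lexx a) hab (lexx b).
pose S' := sort <=%R S.
have mS z : (z \in S') = (z \in S) by rewrite mem_sort.
have sz : size S' = size S by rewrite size_sort.
exists (size S), (seqrule (size S) S' g); split=> //.
- by apply: seqrule_increasing => //; rewrite sort_lt_sorted.
- by move=> i; have := seqrule_in g i sz; rewrite mS => /hS[].
- by move=> i; have := seqrule_in g i sz; rewrite mS => /hS[].
move=> j jn; rewrite quad_seqrule // -eS //; apply: perm_big.
exact: permEl (perm_sort _ _).
Qed.

End Discretization.

(** * The steps of the procedure *)

Section Steps.
Variables (R : realType) (a b : R) (n : nat) (u : nat -> R -> R) (c : nat -> R).
Hypothesis hu : complete_chebyshev_set a b n u.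
Hypothesis hab : a < b.
Variables (N : nat) (P : rule R N).
Hypotheses (nN : (n < N)%N) (incP : increasing_nodes P)
  (inP : forall i, a <= node P i <= b) (posP : positive_weights P)
  (eP : exact_for u c n P).

Lemma strictly_monotonic_inj (al be s t : R) (f : R -> R) :
  strictly_monotonic_on al be f -> al <= s <= be -> al <= t <= be -> f s = f t -> s = t.
Proof.
move=> mf hs ht e.
have hs' : s \in `[al, be] by rewrite in_itv.
have ht' : t \in `[al, be] by rewrite in_itv.
case: (ltgtP s t) => // st.
  by case: mf => mf; [have := mf s t hs' ht' st|have := mf t s ht' hs' st]; rewrite e ltxx.
by case: mf => mf; [have := mf t s ht' hs' st|have := mf s t hs' ht' st]; rewrite e ltxx.
Qed.

Lemma gauss_rule_unique l (r1 r2 : rule R l) : (2 * l <= n)%N ->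
  gauss_rule a b u c r1 -> gauss_rule a b u c r2 -> r1 = r2.
Proof.
move=> ln [inc1 in1 pos1 e1] [inc2 in2 pos2 e2].
have w1 i : a <= node r1 i <= b by case/andP: (in1 i) => /ltW-> /ltW->.
have w2 i : a <= node r2 i <= b by case/andP: (in2 i) => /ltW-> /ltW->.
have mE : mass r1 =1 mass r2.
  apply: (mass_eq (L := codom (node r1) ++ codom (node r2)) hu hab ln e1 e2 w1 w2).
  - by move=> z h; rewrite mem_cat h.
  - by move=> z h; rewrite mem_cat h orbT.
  - by rewrite size_cat !size_codom card_ord mul2n addnn.
have nE : node r1 =1 node r2.
  apply: sorted_codom_eq => [i j /inc1/ltW //|//|_ /codomP[i ->]].
  apply: contraT => /mass_notin; rewrite mE mass_node; last exact: increasing_inj.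
  by move/eqP; rewrite gt_eqF.
apply: rule_eq => // i.
rewrite -(mass_node _ (increasing_inj inc1)) -(mass_node _ (increasing_inj inc2)).
by rewrite mE nE.
Qed.

(** Read off from the positive rule [P]: here [c] is any sequence for which such a rule exists. *)
Lemma orient_moment0 : (0 < n)%N -> 0 < orient a b u 1 * c 0%N.
Proof.
move=> n0; rewrite -(eP n0) /quad mulr_sumr.
have N0 : (0 < N)%N by exact: leq_ltn_trans nN.
rewrite (bigD1 (Ordinal N0)) //= ltr_pwDl //.
  by rewrite mulrCA mulr_gt0 // (orient_u0 hu).
apply: sumr_ge0 => i _; rewrite mulrCA mulr_ge0 // ltW // (orient_u0 hu) //.
Qed.

Lemma moment0_div t : (0 < n)%N -> a <= t <= b -> 0 < c 0%N / u 0%N t.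
Proof.
move=> n0 tab; have h1 := orient_moment0 n0; have h2 := orient_u0 hu hab n0 tab.
have o0 : orient a b u 1 != 0 by apply: contraTneq h1 => ->; rewrite mul0r ltxx.
rewrite (_ : _ / _ = (orient a b u 1 * c 0%N) / (orient a b u 1 * u 0%N t)) ?divr_gt0 //.
by rewrite -mulf_div divff // mul1r.
Qed.

(* The output of step (2a); for [k = 0], the one-point rule at [b] from which
   step (1) starts. *)
Definition upper_rule k (hi : R) (X : rule R k.+1) : Prop :=
  [/\ a < hi, node X ord0 = hi, node X ord_max = b, increasing_nodes X &
      positive_weights X] /\ exact_for u c (2 * k).+1 X.

Section StepA.
Variables (k : nat) (T : rule R k) (i0 : 'I_k).
Hypotheses (i00 : i0 = 0%N :> nat) (kn : (2 * k < n)%N).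
Hypothesis gT : gauss_rule a b u c T.
Let th := node T i0.
Let X := add_null_node T b.

Let X_lift (i : 'I_k) : node X (lift ord_max i) = node T i /\
  weight X (lift ord_max i) = weight T i.
Proof. by rewrite /= liftK. Qed.

Let X_max : node X ord_max = b /\ weight X ord_max = 0.
Proof. by rewrite /= unlift_none. Qed.

Lemma semicanonical_add_null : semicanonical b u c false th X.
Proof.
have [inc inT pos e] := gT.
have liftP (i : 'I_k.+1) : i = ord_max \/ exists j, i = lift ord_max j.
  by case: (unliftP ord_max i) => [j ->|->]; [right; exists j|left].
have [X1 X2] := X_max.
split=> //.
- have -> : ord0 = lift ord_max i0 :> 'I_k.+1.
    by apply/val_inj; rewrite /= /bump i00 leqNgt (leq_ltn_trans _ (ltn_ord i0)).
  exact: (X_lift i0).1.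
- move=> i j; case: (liftP i) => [->|[i' ->]]; case: (liftP j) => [->|[j' ->]].
  + by rewrite ltnn.
  + by rewrite lift_max /= ltnNge ltnW.
  + by rewrite X1 (X_lift _).1 => _; case/andP: (inT i').
  + by rewrite !lift_max !(X_lift _).1 => /inc.
- move=> i; case: (liftP i) => [->|[i' ->]]; first by rewrite addn0 ltnn.
  by rewrite (X_lift _).2.
- rewrite addn0 => j jk; rewrite -e //.
  have -> : quad X (u j) = \sum_(i < k) weight X (widen_ord (leqnSn k) i) *
      u j (node X (widen_ord (leqnSn k) i)) + weight X ord_max * u j (node X ord_max).
    by rewrite /quad big_ord_recr.
  rewrite X2 mul0r addr0.
  apply: eq_bigr => i _; have -> : widen_ord (leqnSn k) i = lift ord_max i.
    by apply/val_inj; rewrite /= /bump leqNgt ltn_ord.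
  by have [-> ->] := X_lift i.
Qed.

Lemma step_2a : exists (x : R -> rule R k.+1) (hi : R),
  [/\ [/\ (forall xi, a <= xi < th -> unique (rule_a b u c xi) (x xi)),
         x th = add_null_node T b,
         continuous_rules_on a th x &
         forall i : 'I_k.+1, (i < k)%N ->
           strictly_increasing_on a th (fun xi => node (x xi) i)],
     (let F := fun xi => quad (x xi) (u (2 * k)%N) - c (2 * k)%N in
      [/\ strictly_monotonic_on a th F,
          unique (fun xi => a <= xi <= th /\ F xi = 0) hi &
          a < hi < th]),
     [/\ positive_weights (x hi),
         node (x hi) ord_max = b,
         (forall i : 'I_k.+1, (i < k)%N -> a < node (x hi) i < b) &
         exact_for u c (2 * k).+1 (x hi)] &
     upper_rule hi (x hi)].
Proof.
have ath : a < th by have [_ inT _ _] := gT; case/andP: (inT i0).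
have kE : (k + false = k)%N by rewrite addn0.
have mE : (2 * k + false = 2 * k)%N by rewrite addn0.
have k0 : (0 < k)%N by exact: leq_ltn_trans (ltn_ord i0).
have k0' : (0 < k + false)%N by rewrite kE.
have mn : (2 * k + false < n)%N by rewrite mE.
have [x [[hx xth cx ix] [mF [hi hin Fhi]]]] := root_finding_step hu hab nN incP inP posP eP
  k0' mn ath semicanonical_add_null X_max.1 (fun _ => X_max.2).
rewrite mE in mF Fhi; rewrite kE in ix.
have [az zth] := andP hin.
have [[x0 inc xm _ e] _ pos] : _ := hx hi (introT andP (conj (ltW az) zth)).
have e1 : exact_for u c (2 * k).+1 (x hi).
  move=> j; rewrite ltnS leq_eqVlt => /orP[/eqP->|jk]; last by rewrite e // mE.
  by apply/eqP; rewrite -subr_eq0; apply/eqP.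
exists x, hi; split.
- split=> // xi xiab; have [s1 _ p1] := hx xi xiab.
  have [y0 inc1 ym _ ey] := s1; rewrite mE in ey.
  split=> // r [r0 rm rinc rpos re].
  case/andP: xiab => axi _.
  apply: (semicanonical_uniq hu hab k0' (ltnW mn) axi s1).
  by split=> //; rewrite mE.
- split=> //; split; first by rewrite !ltW.
  move=> xi [xiab Fxi]; apply: (strictly_monotonic_inj mF) => //; first by rewrite !ltW.
  by rewrite Fhi Fxi.
- split=> // i ik; apply/andP; split; last by rewrite -xm; exact: inc.
  by apply: lt_le_trans az _; rewrite -[X in X <= _]x0; exact: increasing_le.
- by split.
Qed.

End StepA.

Section StepB.
Variables (k : nat) (hi : R) (X : rule R k.+1).
Hypotheses (kn : ((2 * k).+1 < n)%N) (hX : upper_rule hi X).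

Lemma step_2b : exists (y : R -> rule R k.+1) (lo : R),
  [/\ [/\ (forall xi, a <= xi < hi -> unique (rule_b b u c xi) (y xi)),
         y hi = X,
         continuous_rules_on a hi y &
         forall i : 'I_k.+1,
           strictly_increasing_on a hi (fun xi => node (y xi) i)],
     (let G := fun xi => quad (y xi) (u (2 * k).+1) - c (2 * k).+1 in
      [/\ strictly_monotonic_on a hi G,
          unique (fun xi => a <= xi <= hi /\ G xi = 0) lo &
          a < lo < hi]),
     node (y lo) ord0 = lo &
     gauss_rule a b u c (y lo)].
Proof.
have [[ahi X0 Xm Xinc Xpos] Xe] := hX.
have kE : (k + true = k.+1)%N by rewrite addn1.
have mE : (2 * k + true = (2 * k).+1)%N by rewrite addn1.
have k0' : (0 < k + true)%N by rewrite kE.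
have mn : (2 * k + true < n)%N by rewrite mE.
have sX : semicanonical b u c true hi X by split; rewrite ?Xm ?mE.
have [y [[hy yhi cy iy] [mG [lo loin Glo]]]] := root_finding_step hu hab nN incP inP posP eP
  k0' mn ahi sX Xm (fun f => match notF f with end).
rewrite mE in mG Glo; rewrite kE in iy.
have [az zth] := andP loin.
have [[y0 inc _ _ e] ym pos] : _ := hy lo (introT andP (conj (ltW az) zth)).
exists y, lo; split=> //.
- split=> [xi xiab|//|//|i]; last exact: iy (ltn_ord i).
  have [s1 l1 p1] := hy xi xiab.
  have [z0 inc1 zm _ ey] := s1; rewrite mE in ey.
  split=> [|r [r0 rm rinc rpos re]]; first by split=> //; exact: l1.
  case/andP: xiab => axi _.
  apply: (semicanonical_uniq hu hab k0' (ltnW mn) axi s1).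
  by split=> //; rewrite ?mE // ltW.
- split=> //; split; first by rewrite !ltW.
  move=> xi [xiab Gxi]; apply: (strictly_monotonic_inj mG) => //; first by rewrite !ltW.
  by rewrite Glo Gxi.
- split=> //.
  + move=> i; apply/andP; split.
      by apply: lt_le_trans az _; rewrite -[X in X <= _]y0; exact: increasing_le.
    by apply: le_lt_trans (ym isT); apply: increasing_le => //; exact: leq_ord.
  + move=> j; rewrite mulnS add2n ltnS leq_eqVlt => /orP[/eqP->|jk]; last by rewrite e // mE.
    by apply/eqP; rewrite -subr_eq0; apply/eqP.
Qed.

End StepB.
End Steps.

Theorem mainTheorem1 (R : realType) (l : nat) (hl : (1 <= l)%N)
  (a b : R) (hab : a < b)
  (u : nat -> R -> R) (hu : complete_chebyshev_set a b (2 * l) u)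
  (w : R -> R) (hw : forall t, a <= t <= b -> 0 < w t)
  (hwi : (@lebesgue_measure R).-integrable `[a, b] (EFin \o w)) :
  let c := moment a b u w in
  exists (lo hi : nat -> R) (T : forall k, rule R k)
         (x y : forall k, R -> rule R k.+1),
  (* (1) *)
  [/\ unique (fun xi => a < xi < b /\ u 1%N xi / u 0%N xi = c 1%N / c 0%N)
        (lo 1%N),
      strictly_monotonic_on a b (fun t => u 1%N t / u 0%N t),
      T 1%N = Rule (fun=> lo 1%N) (fun=> c 0%N / u 0%N (lo 1%N)),
      0 < c 0%N / u 0%N (lo 1%N) &
      exact_for u c 2 (T 1%N)] /\
  (* (2) *)
  (forall k, (1 <= k < l)%N ->
    (forall i : 'I_k, i = 0%N :> nat -> lo k = node (T k) i) /\
    (* (2a) *)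
    ([/\ (forall xi, a <= xi < lo k -> unique (rule_a b u c xi) (x k xi)),
         x k (lo k) = add_null_node (T k) b,
         continuous_rules_on a (lo k) (x k) &
         forall i : 'I_k.+1, (i < k)%N ->
           strictly_increasing_on a (lo k) (fun xi => node (x k xi) i)] /\
     (let F := fun xi => quad (x k xi) (u (2 * k)%N) - c (2 * k)%N in
      [/\ strictly_monotonic_on a (lo k) F,
          unique (fun xi => a <= xi <= lo k /\ F xi = 0) (hi k) &
          a < hi k < lo k]) /\
     [/\ positive_weights (x k (hi k)),
         node (x k (hi k)) ord_max = b,
         (forall i : 'I_k.+1, (i < k)%N -> a < node (x k (hi k)) i < b) &
         exact_for u c (2 * k).+1 (x k (hi k))]) /\
    (* (2b) *)
    ([/\ (forall xi, a <= xi < hi k -> unique (rule_b b u c xi) (y k xi)),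
         y k (hi k) = x k (hi k),
         continuous_rules_on a (hi k) (y k) &
         forall i : 'I_k.+1,
           strictly_increasing_on a (hi k) (fun xi => node (y k xi) i)] /\
     (let G := fun xi => quad (y k xi) (u (2 * k).+1) - c (2 * k).+1 in
      [/\ strictly_monotonic_on a (hi k) G,
          unique (fun xi => a <= xi <= hi k /\ G xi = 0) (lo k.+1) &
          a < lo k.+1 < hi k]) /\
     T k.+1 = y k (lo k.+1) /\
     gauss_rule a b u c (T k.+1))) /\
  (* conclusion *)
  [/\ a < lo l, lo 1%N < b &
      forall k, (1 <= k < l)%N -> lo k.+1 < hi k /\ hi k < lo k] /\
  unique (@gauss_rule R a b u c l) (T l).
Proof.
move=> c.
have nE : (2 * l)%N = (2 * l).-1.+1 by rewrite prednK // muln_gt0.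
have n0 : (0 < 2 * l)%N by rewrite muln_gt0.
have [N [P [nN incP inP posP eP]]] : exists N (P : rule R N),
   [/\ (2 * l < N)%N, increasing_nodes P, (forall i, a <= node P i <= b),
    positive_weights P & exact_for u c (2 * l) P].
  by move: hu; rewrite nE => hu'; exact: exact_rule_many_nodes.
pose upper := @upper_rule R a b u c.
(* The specification also covers [k = 0], where there is no first node and only the starting point
   [b] is recorded. *)
pose PA k (T : rule R k) (p : (R -> rule R k.+1) * R) :=
  [/\ k = 0%N -> p.2 = b, upper k p.2 (p.1 p.2) & forall i0 : 'I_k, i0 = 0%N :> nat ->
  [/\ [/\ (forall xi, a <= xi < node T i0 -> unique (rule_a b u c xi) (p.1 xi)),
         p.1 (node T i0) = add_null_node T b,
         continuous_rules_on a (node T i0) p.1 &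
         forall i : 'I_k.+1, (i < k)%N ->
           strictly_increasing_on a (node T i0) (fun xi => node (p.1 xi) i)],
     (let F := fun xi => quad (p.1 xi) (u (2 * k)%N) - c (2 * k)%N in
      [/\ strictly_monotonic_on a (node T i0) F,
          unique (fun xi => a <= xi <= node T i0 /\ F xi = 0) p.2 &
          a < p.2 < node T i0]) &
     [/\ positive_weights (p.1 p.2),
         node (p.1 p.2) ord_max = b,
         (forall i : 'I_k.+1, (i < k)%N -> a < node (p.1 p.2) i < b) &
         exact_for u c (2 * k).+1 (p.1 p.2)]]].
pose PB k (hi : R) (X : rule R k.+1) (q : (R -> rule R k.+1) * R) :=
  [/\ [/\ (forall xi, a <= xi < hi -> unique (rule_b b u c xi) (q.1 xi)),
         q.1 hi = X,
         continuous_rules_on a hi q.1 &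
         forall i : 'I_k.+1,
           strictly_increasing_on a hi (fun xi => node (q.1 xi) i)],
     (let G := fun xi => quad (q.1 xi) (u (2 * k).+1) - c (2 * k).+1 in
      [/\ strictly_monotonic_on a hi G,
          unique (fun xi => a <= xi <= hi /\ G xi = 0) q.2 &
          a < q.2 < hi]),
     node (q.1 q.2) ord0 = q.2 &
     gauss_rule a b u c (q.1 q.2)].
(* The steps are made total, with default values where their hypotheses fail, so that the procedure
   can be defined by recursion before its rules are known to be Gaussian. *)
have fA k (T : rule R k) : {p | (k < l)%N -> gauss_rule a b u c T -> PA k T p}.
  apply: cid; case: k T => [|k] T.
    pose X : rule R 1 := Rule (fun=> b) (fun=> c 0%N / u 0%N b).
    exists (fun=> X, b) => _ _; split=> // [|[]//].
    split; last first.
      move=> j; rewrite ltnS leqn0 => /eqP->; rewrite /quad big_ord1 /= divfK //.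
      have := orient_u0 hu hab n0 (t := b); rewrite lexx ltW // => /(_ isT).
      by apply: contraTneq => ->; rewrite mulr0 ltxx.
    split=> // [i j|i]; first by rewrite !ord1.
    by apply: (moment0_div hu hab nN inP posP eP n0); rewrite lexx ltW.
  have [kl|kl] := boolP ((k.+1 < l)%N && `[< gauss_rule a b u c T >]); last first.
    by exists (fun=> add_null_node T b, b) => h1 h2; case/negP: kl; rewrite h1; apply/asboolP.
  case/andP: kl => kl /asboolP gT.
  have kn : (2 * k.+1 < 2 * l)%N by rewrite ltn_pmul2l.
  have [x [hi [h1 h2 h3 h4]]] := step_2a hu hab nN incP inP posP eP (i0 := ord0) erefl kn gT.
  exists (x, hi) => _ _; split=> // i0 i00.
  by have -> : i0 = ord0 by exact/val_inj.
have fB k hi (X : rule R k.+1) : {q | (k < l)%N -> upper k hi X -> PB k hi X q}.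
  apply: cid; have [[kl hX]|h] := pselect ((k < l)%N /\ upper k hi X); last first.
    by exists (fun=> X, b) => h1 h2; case: h.
  have kn : ((2 * k).+1 < 2 * l)%N by have := leq_mul (leqnn 2) kl; rewrite mulnS add2n.
  have [y [lo [h1 h2 h3 h4]]] := step_2b hu hab nN incP inP posP eP kn hX.
  by exists (y, lo).
pose pA k T := sval (fA k T).
pose pB k T := sval (fB k (pA k T).2 ((pA k T).1 (pA k T).2)).
(* The recursion starts from the empty rule, which is vacuously Gaussian. *)
pose T := nat_rect (rule R) (Rule (fun=> b) (fun=> 0)) (fun k T => (pB k T).1 (pB k T).2).
pose hi k := (pA k (T k)).2.
pose x k := (pA k (T k)).1.
pose y k := (pB k (T k)).1.
pose lo k := if k is k'.+1 then (pB k' (T k')).2 else b.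
have hA k : (k < l)%N -> gauss_rule a b u c (T k) -> PA k (T k) (x k, hi k).
  by move=> kl gT; have := svalP (fA k (T k)) kl gT; rewrite /x /hi /pA -surjective_pairing.
have hB k : (k < l)%N -> gauss_rule a b u c (T k) -> PB k (hi k) (x k (hi k)) (y k, lo k.+1).
  move=> kl gT; have [_ hX _] := hA k kl gT.
  by have := svalP (fB k (hi k) (x k (hi k))) kl hX; rewrite /y /lo /pB -surjective_pairing.
have TS k : T k.+1 = y k (lo k.+1) by [].
have gT k : (k <= l)%N -> gauss_rule a b u c (T k).
  elim: k => [_|k IH kl]; first by split; case.
  by have [_ _ _] := hB k kl (IH (ltnW kl)).
have lo_node k (i : 'I_k) : (0 < k <= l)%N -> i = 0%N :> nat -> lo k = node (T k) i.
  case: k i => // k i kl i0; have -> : i = ord0 by exact/val_inj.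
  by have [_ _ -> _] := hB k kl (gT k (ltnW kl)).
have lo_hi k : (k < l)%N -> a < lo k.+1 < hi k.
  by move=> kl; have [_ [_ _ h] _ _] := hB k kl (gT k (ltnW kl)).
have hi_lo k : (0 < k < l)%N -> a < hi k < lo k.
  move=> /andP[k0 kl]; have [_ _ /(_ (Ordinal k0) erefl) [_ [_ _ h] _]] := hA k kl (gT k (ltnW kl)).
  by rewrite (@lo_node k (Ordinal k0)) // k0 ltnW.
have hi0 : hi 0%N = b by have [h _ _] := hA 0%N hl (gT 0%N (ltnW hl)); exact: h.
exists lo, hi, T, x, y; split; last split; last split; last first.
- have gTl := gT l (leqnn l); split=> // r gr.
  exact: (gauss_rule_unique hu hab (leqnn _) gTl gr).
- split.
  + by case: (l) hl lo_hi => // l' _ /(_ l' (ltnSn _)) /andP[].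
  + by have /andP[_] := lo_hi 0%N hl; rewrite hi0.
  + move=> k /andP[k0 kl]; have /andP[_ ->] := lo_hi k kl.
    by have /andP[_ ->] := hi_lo k (introT andP (conj k0 kl)).
- move=> k k0l; have /andP[k0 kl] := k0l.
  have gTk := gT k (ltnW kl).
  have k0l' : (0 < k <= l)%N by rewrite k0 ltnW.
  split; first by move=> i i0; exact: lo_node.
  have [_ _ /(_ (Ordinal k0) erefl)] := hA k kl gTk.
  rewrite -(@lo_node k (Ordinal k0)) // => -[h1 h2 h3].
  have [h4 h5 _ h6] := hB k kl gTk.
  by do 5?[split=> //].
(* Step (1) is the pass [k = 0], whose parameter interval is all of [[a, b]] because [hi 0] is
   [b]. *)
have [[h4 yb _ _] [mG [[lo1ab Glo] loU] /andP[alo lob]] _ gT1] := hB 0%N hl (gT 0%N (ltnW hl)).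
have [_ [[_ xb0 _ _ _] xbe] _] := hA 0%N hl (gT 0%N (ltnW hl)).
rewrite hi0 in h4 yb mG lo1ab Glo loU lob xb0 xbe.
cbn [fst snd] in h4, yb, mG, lo1ab, Glo, loU, lob, xb0, xbe, alo, gT1.
have u0 t : a <= t <= b -> u 0%N t != 0.
  by move=> /(orient_u0 hu hab n0); apply: contraTneq => ->; rewrite mulr0 ltxx.
have c0 : c 0%N != 0.
  by have := orient_moment0 hu hab nN inP posP eP n0; apply: contraTneq => ->; rewrite mulr0 ltxx.
have yE xi : a <= xi <= b ->
    node (y 0%N xi) ord0 = xi /\ weight (y 0%N xi) ord0 = c 0%N / u 0%N xi.
  move=> xiab; have [n1 e1] : node (y 0%N xi) ord0 = xi /\ exact_for u c 1 (y 0%N xi).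
    have /andP[axi] := xiab; rewrite le_eqVlt => /orP[/eqP->|lt]; first by rewrite yb.
    by have [[]] := h4 xi (introT andP (conj axi lt)).
  split=> //; apply: (mulIf (u0 xi xiab)); rewrite divfK ?u0 //.
  by rewrite -(e1 0%N) // /quad big_ord1 n1.
(* For one node the residual is affine in [u 1 / u 0] with slope [c 0], so its zero and its
   monotonicity pass to the quotient, whose direction depends on the sign of [c 0]. *)
have GE xi : a <= xi <= b ->
    quad (y 0%N xi) (u (2 * 0).+1) - c (2 * 0).+1 = c 0%N * (u 1%N xi / u 0%N xi) - c 1%N.
  by move=> /yE[e1 e2]; rewrite /quad big_ord1 e1 e2 mulrAC mulrA.
have lo_ab : a <= lo 1%N <= b by rewrite !ltW.
have T1E : T 1%N = Rule (fun=> lo 1%N) (fun=> c 0%N / u 0%N (lo 1%N)).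
  by have [e1 e2] := yE _ lo_ab; apply: rule_eq => i; rewrite ord1.
split=> //.
- split; first split; first by rewrite alo.
    by apply: (mulfI c0); rewrite [RHS]mulrCA divff // mulr1; apply/eqP; rewrite -subr_eq0 -GE // Glo.
  move=> xi [/andP[axi xib] e]; apply: loU; split; first by rewrite !ltW.
  by rewrite GE ?e ?(ltW axi) ?(ltW xib) // mulrCA divff // mulr1 subrr.
- have [cpos|cneg|/eqP] := ltgtP 0 (c 0%N); last by rewrite eq_sym (negPf c0).
    case: mG => mG; [left|right] => s t hs ht st; have := mG s t hs ht st;
      by move: hs ht; rewrite !in_itv /= => hs ht; rewrite !GE // ltrD2r ltr_pM2l.
  case: mG => mG; [right|left] => s t hs ht st; have := mG t s ht hs st;
    by move: hs ht; rewrite !in_itv /= => hs ht; rewrite !GE // ltrD2r ltr_nM2l.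
- exact: (moment0_div hu hab nN inP posP eP n0 lo_ab).
- by have [_ _ _] := gT1.
Qed.
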